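(* Let $\{x_k\}_{k\ge1}$ be generated by the SQN iteration described in the context, suppose that assumptions AS.1, AS.2, AS.3 and AS.4 (stated in the context) hold, and suppose the batch size is constant, $m_k=m$ for all $k$. Let $\beta\in(0.5,1)$ and let the step sizes be $$\alpha_k=\frac{\underline{\kappa}}{L\bar{\kappa}^2}k^{-\beta},\qquad k\ge1.$$ Let $M_f$ be a positive constant with $\mathbb{E}[f(x_k)]\le M_f$ for all $k$. Then, $N$ denoting the iteration number, $$\frac1N\sum_{k=1}^N\mathbb{E}[\|\nabla f(x_k)\|^2]\le\frac{2L(M_f-f^{low})\bar{\kappa}^2}{\underline{\kappa}^2}N^{\beta-1}+\frac{\sigma^2}{(1-\beta)m}\left(N^{-\beta}-N^{-1}\right).$$ Moreover, for a given $\epsilon\in(0,1)$, to guarantee that $\frac1N\sum_{k=1}^N\mathbb{E}[\|\nabla f(x_k)\|^2]<\epsilon$, the number of iterations $N$ needed is at most $O\left(\epsilon^{-\frac{1}{1-\beta}}\right)$.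
   Context: Setting. $f(x)=\mathbb{E}[F(x,\xi)]$ for $x\in\mathbb{R}^n$, where $F:\mathbb{R}^n\times\mathbb{R}^d\to\mathbb{R}$ is continuously differentiable and possibly nonconvex and $\xi$ is a random vector in $\mathbb{R}^d$. A stochastic first-order oracle returns, for given $x$ and a sample $\xi$, a stochastic gradient $g(x,\xi)\in\mathbb{R}^n$; the distribution of $\xi$ is supported on a set $\Xi\subseteq\mathbb{R}^d$ not depending on $x$. $\|\cdot\|$ is the Euclidean norm, and $A\preceq B$ means $B-A$ is positive semidefinite. SQN (stochastic quasi-Newton) iteration. Given are $x_1\in\mathbb{R}^n$, a positive definite $H_1\in\mathbb{R}^{n\times n}$, batch sizes $m_k\ge 1$ and step sizes $\alpha_k>0$. At iteration $k=1,2,\ldots$: draw samples $\xi_k=(\xi_{k,1},\ldots,\xi_{k,m_k})$ and set $g_k=\frac1{m_k}\sum_{i=1}^{m_k}g(x_k,\xi_{k,i})$; generate a positive definite matrix $H_k$; set $x_{k+1}=x_k-\alpha_kH_kg_k$. Write $\xi_{[k]}=(\xi_1,\ldots,\xi_k)$. Assumptions. AS.1: $f:\mathbb{R}^n\to\mathbb{R}$ is continuously differentiable, $f(x)\ge f^{low}$ for all $x$ for some real $f^{low}$, and $\|\nabla f(x)-\nabla f(y)\|\le L\|x-y\|$ for all $x,y\in\mathbb{R}^n$. AS.2: all samples are independent, the samples of iteration $k$ are independent of $\{x_j\}_{j=1}^k$, and for each $k$ and each sample $\xi$ of iteration $k$ (expectation over that sample) $\mathbb{E}_{\xi}[g(x_k,\xi)]=\nabla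 f(x_k)$ and $\mathbb{E}_{\xi}[\|g(x_k,\xi)-\nabla f(x_k)\|^2]\le\sigma^2$, with $\sigma>0$. AS.3: there are positive constants $\underline{\kappa},\bar{\kappa}$ with $\underline{\kappa}I\preceq H_k\preceq\bar{\kappa}I$ for all $k$. AS.4: for every $k\ge2$, the random matrix $H_k$ depends only on $\xi_{[k-1]}$. A constant $M_f$ as in the claim exists, since these step sizes satisfy $\sum_k\alpha_k=\infty$, $\sum_k\alpha_k^2<\infty$ and $\alpha_k\le\underline{\kappa}/(L\bar{\kappa}^2)$. The constant hidden in $O(\cdot)$ does not depend on $\epsilon$ (it may depend on $L,M_f,f^{low},\underline{\kappa},\bar{\kappa},\sigma,m,\beta$). *)

(* Defs.v *)
From HB Require Import structures.
From mathcomp Require Import all_boot all_order all_algebra.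
From mathcomp Require Import all_classical all_reals all_analysis.

Set Implicit Arguments.
Unset Strict Implicit.
Unset Printing Implicit Defensive.

Import Order.TTheory GRing.Theory Num.Theory.
Import numFieldNormedType.Exports.

Local Open Scope classical_set_scope.
Local Open Scope ring_scope.

(* MathComp-Analysis puts no sigma-algebra on matrices: [borel T] is [T] itself
   (by conversion) carrying its Borel sigma-algebra. *)
Notation borel T := (g_sigma_algebraType (@open T)).

(* The norm `|v| of the library on matrices is the max norm. *)
Definition enorm (R : realType) (n : nat) (v : 'cV[R]_n) : R :=
  Num.sqrt (\sum_i v i ord0 ^+ 2).

Definition grad (R : realType) (n : nat) (f : 'cV[R]_n -> R) (x : 'cV[R]_n) :
    'cV[R]_n :=
  \col_i 'D_(delta_mx i ord0) f x.

Definition continuously_differentiable (R : realType) (V : normedModType R)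
    (f : V -> R) : Prop :=
  (forall x, differentiable f x) /\
  (forall v : V, continuous (fun x => 'D_v f x)).

(* Definiteness of a matrix includes its symmetry. *)
Definition psd (R : realType) (n : nat) (A : 'M[R]_n) : Prop :=
  A^T = A /\ forall v : 'cV[R]_n, 0 <= (v^T *m A *m v) ord0 ord0.

Definition posdef (R : realType) (n : nat) (A : 'M[R]_n) : Prop :=
  A^T = A /\ forall v : 'cV[R]_n, v != 0 -> 0 < (v^T *m A *m v) ord0 ord0.

Definition loewner_le (R : realType) (n : nat) (A B : 'M[R]_n) : Prop :=
  psd (B - A).

Section Independence.
Context {dO : measure_display} {Omega : measurableType dO} {R : realType}.
Variable P : probability Omega R.

(* The sigma-algebra on Omega generated by the random elements X i, i in D. *)
Definition sigma_of {dT : measure_display} {T : measurableType dT} {I : Type}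
    (D : set I) (X : I -> Omega -> T) : set (set Omega) :=
  <<s \bigcup_(i in D) preimage_set_system setT (X i) (@measurable dT T) >>.

Definition mutually_independent {dT : measure_display} {T : measurableType dT}
    {I : eqType} (D : set I) (X : I -> Omega -> T) : Prop :=
  forall (s : seq I) (B : I -> set T),
    uniq s -> (forall i, i \in s -> D i) -> (forall i, measurable (B i)) ->
    P (\big[setI/setT]_(i <- s) (X i @^-1` B i)) =
    \big[mule/1%E]_(i <- s) P (X i @^-1` B i).

Definition independent (G G' : set (set Omega)) : Prop :=
  forall A B, G A -> G' B -> P (A `&` B) = (P A * P B)%E.

End Independence.

(* f x = E[F(x, xi)] for xi of law mu, supported on Xi. The equality in \bar R
   with a real right-hand side entails that F(x, .) is mu-integrable. *)
Definition stochastic_objective (R : realType) (n d : nat)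
    (mu : probability (borel 'cV[R]_d) R) (Xi : set 'cV[R]_d)
    (F : 'cV[R]_n * 'cV[R]_d -> R) (f : 'cV[R]_n -> R) : Prop :=
  [/\ continuously_differentiable F,
      mu.-negligible (~` Xi)
    & forall x, ('E_mu[fun z : borel 'cV[R]_d => F (x, z)] = (f x)%:E)%E].

Definition AS1 (R : realType) (n : nat) (f : 'cV[R]_n -> R) (L flow : R) :
    Prop :=
  [/\ continuously_differentiable f,
      forall x, flow <= f x
    & forall x y, enorm (grad f x - grad f y) <= L * enorm (x - y)].

Section SQN.
Context {R : realType} {n d : nat}.
Context {dO : measure_display} {Omega : measurableType dO}.
Variable P : probability Omega R.
Variable g : 'cV[R]_n -> 'cV[R]_d -> 'cV[R]_n.
(* Iterations are numbered from 1: the values at index 0 are irrelevant. *)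
Variable m : nat -> nat.
Variable xi : forall k, 'I_(m k) -> Omega -> borel 'cV[R]_d.
Variable x : nat -> Omega -> borel 'cV[R]_n.
Variable H : nat -> Omega -> 'M[R]_n.

(* The whole array of samples as one family, indexed by the pairs (k, i). *)
Definition samples (j : {k : nat & 'I_(m k)}) : Omega -> borel 'cV[R]_d :=
  @xi (tag j) (tagged j).

Definition batch_gradient (k : nat) (w : Omega) : 'cV[R]_n :=
  (m k)%:R^-1 *: \sum_i g (x k w) (@xi k i w).

Definition sqn_iteration (mu : probability (borel 'cV[R]_d) R)
    (alpha : nat -> R) (x1 : 'cV[R]_n) (H1 : 'M[R]_n) : Prop :=
  [/\ measurable_fun [set: borel 'cV[R]_n * borel 'cV[R]_d]
        (fun p => g p.1 p.2 : borel 'cV[R]_n),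
      forall k i, (0 < k)%N ->
        measurable_fun [set: Omega] (@xi k i) /\
        forall B : set (borel 'cV[R]_d),
          measurable B -> P (@xi k i @^-1` B) = mu B,
      (forall w, x 1%N w = x1) /\ (forall w, H 1%N w = H1),
      forall k w, (0 < k)%N -> posdef (H k w)
    & forall k w, (0 < k)%N ->
        x k.+1 w = x k w - alpha k *: (H k w *m batch_gradient k w)].

(* In the last two clauses the iterate x k w is frozen and the expectation is
   over the sample alone. *)
Definition AS2 (f : 'cV[R]_n -> R) (sigma : R) : Prop :=
  [/\ mutually_independent P [set j | (0 < tag j)%N] samples,
      forall k, (0 < k)%N ->
        independent P (sigma_of [set j | tag j = k] samples)
                      (sigma_of [set j | (0 < j <= k)%N] x),
      forall k i, (0 < k)%N ->
        {ae P, forall w, forall l : 'I_n,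
          ('E_P[fun w' => g (x k w) (@xi k i w') l ord0] =
           (grad f (x k w) l ord0)%:E)%E}
    & forall k i, (0 < k)%N ->
        {ae P, forall w,
          ('E_P[fun w' =>
               (enorm (g (x k w) (@xi k i w') - grad f (x k w)) ^+ 2)%R]
           <= (sigma ^+ 2)%:E)%E}].

Definition AS3 (kl ku : R) : Prop :=
  forall k, (0 < k)%N ->
    {ae P, forall w, loewner_le kl%:M (H k w) /\ loewner_le (H k w) ku%:M}.

(* H k depends only on the samples of the iterations 1, ..., k - 1. *)
Definition AS4 : Prop :=
  forall k, (2 <= k)%N ->
    preimage_set_system setT (H k) (@measurable _ (borel 'M[R]_n)) `<=`
    sigma_of [set j | (0 < tag j < k)%N] samples.

Definition mean_sq_grad (f : 'cV[R]_n -> R) (N : nat) : \bar R :=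
  (N%:R^-1%:E *
   \sum_(1 <= k < N.+1) 'E_P[fun w => (enorm (grad f (x k w)) ^+ 2)%R])%E.

End SQN.

(* Main.v *)
(** Since [H_k] depends only on the samples drawn before iteration [k], the
    gradient error of that iteration is centered given the past and uncorrelated
    between the samples of a batch. Put [A = 2 L ku^2 / kl^2],
    [phi_k = A (E f(x_k) - flow)], [a_k = E |grad f(x_k)|^2], [y_k = k^beta] and
    [s = sigma^2 / m]. The smoothness of [f] gives
      [a_k (2 - 1 / y_k) <= y_k (phi_k - phi_(k+1)) + s / y_k].
    Weakening [2 - 1 / y_k] to [1] and summing yields the sum of the [1 / y_k]
    from [k = 1], which exceeds [(N^(1-beta) - 1) / (1 - beta)]: that integral
    only dominates the sum from [k = 2]. The first term is paid for by keeping
    the factor [2 - 1 / y_k] and by [a_k <= phi_k], a consequence of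
    [|grad f|^2 <= 2 L (f - flow)] and [kl <= ku]. *)
Require Import Defs.
From HB Require Import structures.
From mathcomp Require Import all_boot all_order all_algebra.
From mathcomp Require Import all_classical all_reals all_analysis.
From mathcomp Require Import measurable_realfun.
From mathcomp Require Import ring lra.
Import Order.TTheory GRing.Theory Num.Theory.
Import numFieldNormedType.Exports.
Local Open Scope classical_set_scope.
Local Open Scope ring_scope.

Set Implicit Arguments.
Unset Strict Implicit.
Unset Printing Implicit Defensive.

(** * Real sequences *)

(** Conditional expectations are avoided. [Omega] with the sigma-algebra of all samples up to
    iteration [k] except one is taken as a measurable space of its own. The identity map into it is
    independent of the omitted sample, so their joint law is a product, and Fubini turns an
    expectation into an iterated integral whose inner part freezes the iterate: the form in which
    [AS2] gives mean and variance. Omitting a single sample rather than the batch lets one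
    orthogonality lemma give both the centering given the past and the uncorrelatedness inside the
    batch. Integrability has to be earned: the bounds [flow] and [Mf] make [f (x k)] integrable, and
    [|grad f|^2 <= 2 L (f - flow)] passes this on to the gradient. In the summation, division by
    [2 - 1 / y] leaves the weight [y^2 / (2 y - 1)]. It stays below [y] by at least [1 - 1 / y], and
    this slack is what pays for the first term. *)

Lemma weight_homo (R : realFieldType) (y z : R) : 1 <= y -> y <= z ->
  y ^+ 2 / (2 * y - 1) <= z ^+ 2 / (2 * z - 1).
Proof.
move=> y1 yz.
rewrite ler_pdivrMr; last by lra.
rewrite mulrAC ler_pdivlMr; last by lra.
rewrite -subr_ge0.
have -> : z ^+ 2 * (2 * y - 1) - y ^+ 2 * (2 * z - 1)
  = (z - y) * (2 * (y - 1) * (z - 1) + (y - 1) + (z - 1)) by ring.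
apply: mulr_ge0; first by lra.
have : 0 <= (y - 1) * (z - 1) by apply: mulr_ge0; lra.
by lra.
Qed.

Lemma weight_ge1 (R : realFieldType) (y : R) : 1 <= y ->
  1 <= y ^+ 2 / (2 * y - 1).
Proof.
move=> y1; rewrite ler_pdivlMr; last by lra.
by rewrite -subr_ge0 (_ : _ - _ = (y - 1) ^+ 2) ?sqr_ge0//; ring.
Qed.

(** The gap between the two sides is [(y - 1)^3 / (y (2 y - 1))]. What matters is the summand
    [1 / y - 1], a gain over the plain bound by [y]. *)
Lemma weight_le (R : realFieldType) (y : R) : 1 <= y ->
  y ^+ 2 / (2 * y - 1) <= y + y^-1 - 1.
Proof.
move=> y1; rewrite ler_pdivrMr; last by lra.
rewrite -subr_ge0.
have -> : (y + y^-1 - 1) * (2 * y - 1) - y ^+ 2 = (y - 1) ^+ 3 / y.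
  by field; lra.
by rewrite divr_ge0// ?exprn_ge0//; lra.
Qed.

Lemma addV_homo (R : realFieldType) (y z : R) : 1 <= y -> y <= z ->
  y + y^-1 <= z + z^-1.
Proof.
move=> y1 yz; rewrite -subr_ge0.
have -> : z + z^-1 - (y + y^-1) = (z - y) * (y * z - 1) / (y * z).
  by field; apply/andP; split; lra.
have yz1 : 1 <= y * z by nra.
by rewrite divr_ge0 ?mulr_ge0//; lra.
Qed.

Section DescentSum.
Variables (R : realFieldType) (a phi y : nat -> R) (D s : R).
Hypothesis s_ge0 : 0 <= s.
Hypothesis y1 : y 1%N = 1.
Hypothesis y_homo : forall k, (0 < k)%N -> y k <= y k.+1.
Hypothesis phi_ge0 : forall k, (0 < k)%N -> 0 <= phi k.
Hypothesis phi_le : forall k, (0 < k)%N -> phi k <= D.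
Hypothesis a_le : forall k, (0 < k)%N -> a k <= phi k.
Hypothesis descent : forall k, (0 < k)%N ->
  a k * (2 - (y k)^-1) <= y k * (phi k - phi k.+1) + s / y k.

Let y_ge1 k : (0 < k)%N -> 1 <= y k.
Proof.
case: k => // k _; elim: k => [|k IH]; first by rewrite y1.
exact: (le_trans IH (y_homo _)).
Qed.

(** Coefficient left on [phi k - phi k.+1] once the descent inequality is divided by [2 - 1 / y k].
    It is 1 at [k = 1] and grows with [k]. *)
Let w k := y k ^+ 2 / (2 * y k - 1).

Let a_le_w k : (0 < k)%N -> a k <= w k * (phi k - phi k.+1) + s / (2 * y k - 1).
Proof.
move=> k0; have y1k := y_ge1 k0.
have y0 : y k != 0 by lra.
have c0 : 0 < 2 * y k - 1 by lra.
rewrite /w mulrAC -mulrDl ler_pdivlMr//.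
have := descent k0; rewrite -(ler_pM2l (_ : 0 < y k)); last by lra.
congr (_ <= _); by field.
Qed.

(** Summation by parts: since [D - phi] is nonnegative, the weight in front of it may be raised to
    the next one before a new decrease of [phi] is added. [Num.min D s] is the cost of the first
    term: [D] by way of [a 1 <= phi 1], [s] by way of descent. *)
Let sum_le_aux N : \sum_(1 <= k < N.+2) a k <=
  w N.+1 * (D - phi N.+2) + s * (\sum_(2 <= k < N.+2) (y k)^-1) + Num.min D s.
Proof.
elim: N => [|N IH].
  rewrite big_nat1 big_geq// mulr0 addr0 /w y1.
  rewrite (_ : 1 ^+ 2 / (2 * 1 - 1) = 1 :> R); last by field.
  have := phi_le (isT : (0 < 2)%N); have := phi_le (isT : (0 < 1)%N).
  have := a_le (isT : (0 < 1)%N); have := descent (isT : (0 < 1)%N).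
  by rewrite y1 invr1; case: (leP D s) => _; lra.
rewrite big_nat_recr//= [in leRHS]big_nat_recr//=.
have yN := y_ge1 (isT : (0 < N.+2)%N).
have h1 : w N.+1 * (D - phi N.+2) <= w N.+2 * (D - phi N.+2).
  rewrite ler_wpM2r ?subr_ge0 ?phi_le//.
  by apply: weight_homo; [exact: y_ge1|exact: y_homo].
have h2 : s / (2 * y N.+2 - 1) <= s * (y N.+2)^-1.
  by rewrite ler_wpM2l// lef_pV2 ?posrE; lra.
have := a_le_w (isT : (0 < N.+2)%N).
by move: h1 h2 IH; rewrite /=; lra.
Qed.

(* The first term is bounded either by [phi 1] or by its descent inequality and
   the last one by [phi N]; the terms in between telescope with the increasing
   weights [w k]. This is what makes the sum of the [(y k)^-1] start at 2. *)
Lemma descent_sum N : (0 < N)%N ->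
  \sum_(1 <= k < N.+1) a k <= y N * D + s * \sum_(2 <= k < N.+1) (y k)^-1.
Proof.
case: N => // -[_|N _].
  rewrite big_nat1 big_geq// mulr0 addr0 y1 mul1r.
  by apply: le_trans (a_le _) (phi_le _).
rewrite big_nat_recr//= [in leRHS]big_nat_recr//=.
have D0 : 0 <= D by apply: le_trans (phi_ge0 (isT : (0 < 1)%N)) (phi_le _).
have := sum_le_aux N; have := a_le (isT : (0 < N.+2)%N).
have p0 := phi_ge0 (isT : (0 < N.+2)%N).
have yN := y_ge1 (isT : (0 < N.+1)%N).
have yNN : y N.+1 <= y N.+2 by exact: y_homo.
have h1 : 1 <= w N.+1 by exact: weight_ge1.
have h2 : w N.+1 <= y N.+2 + (y N.+2)^-1 - 1.
  by have := weight_le yN; have := addV_homo yN yNN; rewrite /w; lra.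
have v1 : (y N.+2)^-1 <= 1 by rewrite invf_le1; lra.
(* The last term, bounded by [phi N.+2], is absorbed by the [- w N.+1 * phi N.+2] which the
   telescoping leaves. *)
have h3 : phi N.+2 <= w N.+1 * phi N.+2 by rewrite ler_peMl.
have h4 : w N.+1 * D <= (y N.+2 + (y N.+2)^-1 - 1) * D by rewrite ler_wpM2r.
(* The slack [D (1 - 1 / y)] of [h4] lowers the cost of the first term to [s / y], the summand at
   [N.+2], still free because descent was not applied to the last term. *)
have h5 : D * (y N.+2)^-1 - D + Num.min D s <= s * (y N.+2)^-1.
  case: (leP D s) => Ds.
    have : D * (y N.+2)^-1 <= s * (y N.+2)^-1.
      by rewrite ler_wpM2r// invr_ge0; lra.
    by lra.
  have : 0 <= (D - s) * (1 - (y N.+2)^-1) by apply: mulr_ge0; lra.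
  by lra.
by move: h3 h4 h5 => /=; lra.
Qed.

End DescentSum.

(** * Real powers: the sum of the step sizes and the iteration threshold *)

Section RealPowers.
Context {R : realType}.
Implicit Types (p t e beta : R).

(** Bernoulli's inequality for an exponent in [(0, 1)]: Young's inequality for [t^p] and [1] with
    conjugate exponents [1 / p] and [1 / (1 - p)]. *)
Lemma powR_le1D p t : 0 < p -> p < 1 -> 0 < t -> t `^ p <= 1 + p * (t - 1).
Proof.
move=> p0 p1 t0.
have q0 : 0 < 1 - p by lra.
have := @conjugate_powR R (t `^ p) 1 p^-1 (1 - p)^-1 (powR_ge0 _ _) ler01.
rewrite !invr_gt0 !invrK p0 q0 => /(_ isT isT).
rewrite -powRrM divff ?gt_eqF// (powRr1 (ltW t0)) powR1 mulr1 mul1r.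
by move=> /(_ ltac:(lra)); lra.
Qed.

(** The right side is the integral of [t^(-beta)] over [[1, N]]. The induction compares each summand
    with the increment of the antiderivative. *)
Lemma sum_powRN_le beta N : 0 < beta -> beta < 1 -> (0 < N)%N ->
  \sum_(2 <= k < N.+1) k%:R `^ (- beta) <=
  (1 - beta)^-1 * (N%:R `^ (1 - beta) - 1).
Proof.
move=> b0 b1; case: N => // N _; elim: N => [|N IH].
  by rewrite big_geq// (_ : 1%N%:R = 1 :> R)// powR1 subrr mulr0.
rewrite big_nat_recr//=; apply: le_trans (lerD IH (lexx _)) _.
have c0 : 0 < 1 - beta by lra.
rewrite -(ler_pM2l c0) mulrDr !mulrA divff ?gt_eqF// !mul1r.
set y : R := N.+2%:R.
have y0 : 0 < y by rewrite ltr0n.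
(* With [y^(1 - beta)] factored out, the comparison becomes Bernoulli's inequality at
   [1 - 1 / y]. *)
have -> : (N.+1%:R : R) = y * (1 - y^-1).
  by rewrite mulrBr mulr1 divff ?gt_eqF// /y -[N.+2]addn1 natrD addrK.
have yV : 0 < 1 - y^-1.
  by rewrite subr_gt0 invf_lt1// ltr1n.
rewrite powRM ?(ltW y0) ?(ltW yV)//.
have -> : y `^ (- beta) = y `^ (1 - beta) * y^-1.
  by rewrite -(powR_inv1 (ltW y0)) -powRD ?(gt_eqF y0) ?implybT//; congr powR; ring.
have := powR_le1D c0 (_ : 1 - beta < 1) yV.
move=> /(_ ltac:(lra)) h.
have := ler_wpM2l (powR_ge0 y (1 - beta)) h.
by move: (y `^ (1 - beta)) ((1 - y^-1) `^ (1 - beta)) (y^-1) => A B C; nra.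
Qed.

Lemma powR_threshold (K e p : R) : 0 <= K -> 0 < p -> 0 < e -> e < 1 ->
  exists N0 : nat, [/\ (0 < N0)%N,
    N0%:R <= ((K `^ p^-1 + 1) * e `^ (- p^-1)) &
    forall N, (N0 <= N)%N -> K * N%:R `^ (- p) < e].
Proof.
move=> K0 p0 e0 e1.
(* For [K > 0] this solves [K t^(-p) = e]. Rounding up costs at most 1, which [e^(-1/p) >= 1]
   absorbs. *)
pose t := K `^ p^-1 * e `^ (- p^-1).
have t0 : 0 <= t by rewrite mulr_ge0 ?powR_ge0.
exists (Num.truncn t).+1; split => //.
  rewrite mulrDl mul1r -addn1 natrD lerD//; first by rewrite truncn_le.
  rewrite powRN invf_ge1 ?powR_gt0//.
  by rewrite -(powRr0 e) ger_powR ?e0 ?(ltW e1)// invr_ge0 ltW.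
move=> N tN.
have tN' : t < N%:R.
  by apply: lt_le_trans (truncnS_gt _) _; rewrite ler_nat.
have N0 : 0 < N%:R :> R by apply: le_lt_trans tN'.
rewrite powRN ltr_pdivrMr ?powR_gt0//.
have := @gt0_ltr_powR R p p0 t N%:R.
rewrite !nnegrE t0 ltW// tN' => /(_ isT isT isT).
rewrite powRM ?powR_ge0// -!powRrM mulVf ?gt_eqF// mulNr mulVf ?gt_eqF//.
rewrite powRr1// (powR_inv1 (ltW e0)).
by rewrite ltr_pdivrMr// mulrC.
Qed.

End RealPowers.

(** * Euclidean geometry and smoothness *)

Section Dot.
Context {R : realType} {n : nat}.
Implicit Types (u v w : 'cV[R]_n) (A : 'M[R]_n).

Definition dot u v : R := (u^T *m v) ord0 ord0.

Lemma dotE u v : dot u v = \sum_i u i ord0 * v i ord0.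
Proof. by rewrite /dot mxE; apply: eq_bigr => i _; rewrite mxE. Qed.

Lemma dotC u v : dot u v = dot v u.
Proof. by rewrite !dotE; apply: eq_bigr => i _; rewrite mulrC. Qed.

Lemma dotDl u v w : dot (u + v) w = dot u w + dot v w.
Proof. by rewrite /dot linearD/= mulmxDl mxE. Qed.

Lemma dotDr u v w : dot u (v + w) = dot u v + dot u w.
Proof. by rewrite /dot mulmxDr mxE. Qed.

Lemma dotZl (a : R) u v : dot (a *: u) v = a * dot u v.
Proof. by rewrite /dot linearZ/= -scalemxAl mxE. Qed.

Lemma dotZr (a : R) u v : dot u (a *: v) = a * dot u v.
Proof. by rewrite /dot -scalemxAr mxE. Qed.

Lemma dotNl u v : dot (- u) v = - dot u v.
Proof. by rewrite -scaleN1r dotZl mulN1r. Qed.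

Lemma dotNr u v : dot u (- v) = - dot u v.
Proof. by rewrite -scaleN1r dotZr mulN1r. Qed.

Definition dotp := (dotDl, dotDr, dotZl, dotZr, dotNl, dotNr).

Lemma dot_sumr (I : Type) (r : seq I) (F : I -> 'cV[R]_n) u :
  dot u (\sum_(i <- r) F i) = \sum_(i <- r) dot u (F i).
Proof.
elim/big_rec2: _ => [|i x y _ <-]; last by rewrite dotDr.
by rewrite /dot mulmx0 mxE.
Qed.

Lemma dot_mulmx A u v : A^T = A -> dot u (A *m v) = dot (A *m u) v.
Proof. by move=> sA; rewrite /dot trmx_mul sA mulmxA. Qed.

Lemma dotvv_ge0 u : 0 <= dot u u.
Proof. by rewrite dotE sumr_ge0// => i _; rewrite -expr2 sqr_ge0. Qed.

Lemma dotvv_eq0 u : dot u u = 0 -> u = 0.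
Proof.
rewrite dotE => /eqP; rewrite psumr_eq0 => [|i _]; last by rewrite -expr2 sqr_ge0.
move=> /allP u0; apply/colP => i; rewrite mxE.
have := u0 i (mem_index_enum _).
by rewrite -expr2 sqrf_eq0 => /eqP.
Qed.

Lemma enorm_sqr u : enorm u ^+ 2 = dot u u.
Proof.
rewrite /enorm sqr_sqrtr; last by rewrite sumr_ge0// => i _; exact: sqr_ge0.
by rewrite dotE; apply: eq_bigr => i _; rewrite expr2.
Qed.

Lemma enorm_ge0 u : 0 <= enorm u.
Proof. exact: sqrtr_ge0. Qed.

Lemma enormZ (a : R) u : 0 <= a -> enorm (a *: u) = a * enorm u.
Proof.
move=> a0; apply/eqP; rewrite -(@eqrXn2 _ 2) ?mulr_ge0 ?enorm_ge0//.
by rewrite enorm_sqr exprMn enorm_sqr !dotp mulrA expr2.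
Qed.

(** Cauchy-Schwarz, from the square of [|v| u - |u| v]. Zero norms are set apart because the factor
    [|u| |v|] gets cancelled. *)
Lemma dot_le_enorm u v : dot u v <= enorm u * enorm v.
Proof.
have [u0|un0] := eqVneq (enorm u) 0.
  have /dotvv_eq0 -> : dot u u = 0 by rewrite -enorm_sqr u0 expr0n.
  by rewrite /dot trmx0 mul0mx mxE mulr_ge0 ?enorm_ge0.
have [v0|vn0] := eqVneq (enorm v) 0.
  have /dotvv_eq0 -> : dot v v = 0 by rewrite -enorm_sqr v0 expr0n.
  by rewrite /dot mulmx0 mxE mulr_ge0 ?enorm_ge0.
have c0 : 0 < enorm u * enorm v by rewrite mulr_gt0 // lt_def ?un0 ?vn0 enorm_ge0.
have := dotvv_ge0 (enorm v *: u - enorm u *: v).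
rewrite !dotp -!enorm_sqr (dotC v u).
rewrite [leRHS](_ : _ =
  2 * (enorm u * enorm v) * (enorm u * enorm v - dot u v)); last by ring.
by rewrite pmulr_rge0 ?subr_ge0// mulr_gt0.
Qed.

Lemma psd_ge0 A v : psd A -> 0 <= dot v (A *m v).
Proof. by move=> [_ /(_ v)]; rewrite /dot mulmxA. Qed.

Lemma dot_scalar_mx (a : R) u v : dot u (a%:M *m v) = a * dot u v.
Proof. by rewrite mul_scalar_mx dotZr. Qed.

Lemma loewner_ge_dot (a : R) A v : loewner_le a%:M A ->
  a * dot v v <= dot v (A *m v).
Proof.
by move=> /(psd_ge0 v); rewrite mulmxBl !dotp dot_scalar_mx subr_ge0.
Qed.

Lemma loewner_le_dot (b : R) A v : loewner_le A b%:M ->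
  dot v (A *m v) <= b * dot v v.
Proof.
by move=> /(psd_ge0 v); rewrite mulmxBl !dotp dot_scalar_mx subr_ge0.
Qed.

(* From [0 <= A <= b] one gets [A^2 <= b A], evaluating the form [A] at
   [b v - A v] and the form [b - A] at [A v]. *)
Lemma loewner_mulmx_le (b : R) A v : 0 < b -> A^T = A ->
  (forall u, 0 <= dot u (A *m u)) -> loewner_le A b%:M ->
  dot (A *m v) (A *m v) <= b ^+ 2 * dot v v.
Proof.
move=> b0 sA A0 Ab.
have h1 := A0 (b *: v - A *m v).
have h2 := loewner_le_dot (A *m v) Ab.
have h3 := loewner_le_dot v Ab.
move: h1; rewrite mulmxBr -scalemxAr !dotp.
rewrite (dot_mulmx v (A *m v) sA) (dotC (A *m v) (A *m (A *m v))).
rewrite (dotC (A *m (A *m v)) (A *m v)).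
move: (dot (A *m v) (A *m v)) (dot (A *m v) (A *m (A *m v))) h2 => p q h2.
move=> h1.
have h4 : b * p <= b * (b * dot v (A *m v)).
  by move: h1 h2; lra.
move: h4; rewrite ler_pM2l// => h4; apply: le_trans h4 _.
by rewrite expr2 -mulrA ler_pM2l.
Qed.

(** Both forms are tested on the all-ones vector, nonzero only in positive dimension. In dimension 0
    the matrix order says nothing about [a] and [b]. *)
Lemma loewner_scalar_le (a b : R) A : (0 < n)%N ->
  loewner_le a%:M A -> loewner_le A b%:M -> a <= b.
Proof.
move=> n0 /loewner_ge_dot aA /loewner_le_dot Ab.
pose v : 'cV[R]_n := const_mx 1.
have v0 : 0 < dot v v.
  rewrite dotE (eq_bigr (fun=> 1)); last by move=> i _; rewrite !mxE mulr1.
  by rewrite sumr_const card_ord ltr0n.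
by rewrite -(ler_pM2r v0); exact: le_trans (aA v) (Ab v).
Qed.

Lemma derive_dot_grad (f : 'cV[R]_n -> R) x v : differentiable f x ->
  'D_v f x = dot (grad f x) v.
Proof.
move=> df; rewrite deriveE// {1}(matrix_sum_delta v) linear_sum dotE.
apply: eq_bigr => i _; rewrite big_ord1 linearZ/= mxE deriveE//.
by rewrite mulrC.
Qed.

(** [psi] is [f] along the segment minus its quadratic model. Cauchy-Schwarz and the Lipschitz
    gradient make its derivative nonpositive on [[0, 1]], so the mean value theorem suffices and no
    gradient is integrated. *)
Lemma descent_lemma (f : 'cV[R]_n -> R) (L flow : R) x v :
  AS1 f L flow -> 0 < L ->
  f (x + v) <= f x + dot (grad f x) v + L / 2 * dot v v.
Proof.
move=> [[df _] _ lip] L0.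
pose psi (t : R) := f (x + t *: v)
  - (t * dot (grad f x) v + L / 2 * t ^+ 2 * dot v v).
pose dpsi (t : R) := 'D_v f (x + t *: v)
  - (dot (grad f x) v + L * t * dot v v).
have dphi (t : R) : is_derive t 1 (fun t => f (x + t *: v)) ('D_v f (x + t *: v)).
  have E : (fun h : R => h^-1 *: (((fun t => f (x + t *: v)) \o shift t) (h *: 1)
        - f (x + t *: v))) =
      (fun h => h^-1 *: ((f \o shift (x + t *: v)) (h *: v) - f (x + t *: v))).
    apply/funext => h /=; congr (_ *: (f _ - _)).
    by rewrite [h *: 1]mulr1 scalerDl addrCA.
  apply: DeriveDef; last by rewrite /derive E.
  by rewrite /derivable E; exact: diff_derivable.
have dpol (t : R) : is_derive t 1
   (fun t => t * dot (grad f x) v + L / 2 * t ^+ 2 * dot v v)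
   (dot (grad f x) v + L * t * dot v v).
  apply: is_derive_eq; rewrite /GRing.scale /=.
  by field.
have dpsiE (t : R) : is_derive t 1 psi (dpsi t) by exact: is_deriveB.
have cpsi : {within `[0, 1], continuous psi}.
  by apply: derivable_within_continuous => t _.
have [c] := MVT ltr01 (fun t _ => dpsiE t) cpsi.
rewrite in_itv /= => /andP[c0 c1]; rewrite subr0 mulr1 => /eqP.
rewrite /psi scale1r scale0r addr0 expr0n /= !mul0r !mulr0 mul0r addr0 subr0.
rewrite expr1n mul1r mulr1 => /eqP psiE.
suff : dpsi c <= 0 by move: psiE; lra.
rewrite /dpsi derive_dot_grad// opprD addrA -dotNl -dotDl.
rewrite subr_le0; apply: le_trans (dot_le_enorm _ _) _.
apply: le_trans (ler_wpM2r (enorm_ge0 _) (lip _ _)) _.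
by rewrite addrAC subrr add0r (enormZ _ (ltW c0)) -enorm_sqr expr2 !mulrA.
Qed.

(* The part of the bound which is linear in the gradient error [e] is isolated:
   it vanishes in expectation. *)
Lemma sqn_step_descent (f : 'cV[R]_n -> R) (L flow kl ku a : R) A x e :
  AS1 f L flow -> 0 < L -> 0 < kl -> 0 < ku -> A^T = A ->
  loewner_le kl%:M A -> loewner_le A ku%:M -> 0 <= a ->
  f (x - a *: (A *m (grad f x + e))) <=
    f x + (L / 2 * a ^+ 2 * ku ^+ 2 - a * kl) * dot (grad f x) (grad f x)
    + L / 2 * a ^+ 2 * ku ^+ 2 * dot e e
    + dot ((- a) *: (A *m grad f x) + (L * a ^+ 2 * ku ^+ 2) *: grad f x) e.
Proof.
move=> as1 L0 kl0 ku0 sA klA Aku a0; set v := grad f x.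
have A0 u : 0 <= dot u (A *m u).
  by apply: le_trans (loewner_ge_dot u klA); rewrite mulr_ge0 ?dotvv_ge0// ltW.
apply: le_trans (descent_lemma x (- (a *: (A *m (v + e)))) as1 L0) _.
(* The cross term [2 <v, e>] of this bound is kept exact and gives [L a^2 ku^2 <v, e>]; the symmetry
   of [A] turns [<v, A e>] into [<A v, e>]. *)
have h1 := loewner_mulmx_le (v + e) ku0 sA A0 Aku.
have h2 := loewner_ge_dot v klA.
rewrite -/v mulmxDr.
rewrite mulmxDr in h1; move: h1.
rewrite !dotp !(dot_mulmx v _ sA) (dotC e v).
move: h2; rewrite (dot_mulmx v v sA).
move: (dot (A *m v) v) (dot (A *m v) e) (dot v v) (dot v e) (dot e e)
  (dot (A *m v) (A *m v)) (dot (A *m v) (A *m e)) (dot (A *m e) (A *m v))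
  (dot (A *m e) (A *m e)) => p q r s t u1 u2 u3 u4 h2 h1.
have h3 : a * (kl * r) <= a * p by rewrite ler_wpM2l.
have c0 : 0 <= L / 2 * a ^+ 2 by rewrite mulr_ge0 ?sqr_ge0//; lra.
have := ler_wpM2l c0 h1.
by lra.
Qed.

(** A gradient step of length [1 / L] lowers [f] by at least [|grad f|^2 / (2 L)] and cannot lead
    below [flow]. *)
Lemma grad_sqr_le (f : 'cV[R]_n -> R) (L flow : R) x : AS1 f L flow -> 0 < L ->
  dot (grad f x) (grad f x) <= 2 * L * (f x - flow).
Proof.
move=> H L0; have := descent_lemma x (- L^-1 *: grad f x) H L0.
have [_ flowf _] := H; have := flowf (x + - L^-1 *: grad f x).
rewrite !dotp; set p := dot _ _; move=> h1 h2.
have {h1 h2} : flow <= f x + - L^-1 * p + L / 2 * (- L^-1 * (- L^-1 * p)).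
  exact: le_trans h2.
have -> : f x + - L^-1 * p + L / 2 * (- L^-1 * (- L^-1 * p)) =
  f x - p / (2 * L) by field; lra.
rewrite lerBrDr addrC -lerBrDr ler_pdivrMr; last by lra.
by rewrite mulrC.
Qed.

End Dot.

(** * Measurability *)

Section Borel.
Context {R : realType}.

Lemma continuous_borel_measurable (T : ptopologicalType) (h : T -> R) :
  continuous h -> measurable_fun [set: borel T] h.
Proof.
move=> /continuousP ch; apply: (measurability _ (RGenOpens.measurableE R)).
move=> _ [_ [a [b ->] <-]]; rewrite setTI; apply: sub_sigma_algebra.
exact/ch/interval_open.
Qed.

Lemma coord_measurable m n (i : 'I_m) (j : 'I_n) :
  measurable_fun [set: borel 'M[R]_(m, n)] (fun A : 'M[R]_(m, n) => A i j).
Proof.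
apply: (@continuous_borel_measurable 'M[R]_(m, n)).
exact: (@coord_continuous R m n i j).
Qed.

(** Rational centres and radii keep the family countable. The condition that a box lies in [A] sits
    inside the set, so the union runs over a whole countable type. *)
Lemma open_bigcup_box n (A : set 'cV[R]_n) : open A ->
  A = \bigcup_(q : 'cV[rat]_n * rat)
    [set y | (forall i, y i ord0 \in
        `]ratr (q.1 i ord0) - ratr q.2, ratr (q.1 i ord0) + ratr q.2[) /\
      (forall z : 'cV[R]_n, (forall i, z i ord0 \in
        `]ratr (q.1 i ord0) - ratr q.2, ratr (q.1 i ord0) + ratr q.2[) -> A z)].
Proof.
move=> oA; apply/seteqP; split; last first.
  by move=> y [q _ [yq qA]]; exact: qA.
move=> y Ay; have /nbhs_ballP[e /= e0 yA] : nbhs y A by exact: open_nbhs_nbhs.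
(* With [r < e / 2] and a centre within [r] of [y], every point of the box is within [2 r < e] of
   [y]. *)
have [r] := rat_in_itvoo (divr_gt0 e0 (ltr0n R 2) : 0 < e / 2).
rewrite in_itv /= => /andP[r0 re].
have qP i : exists q : rat, ratr q \in `]y i ord0 - ratr r, y i ord0 + ratr r[%R.
  by apply: rat_in_itvoo; lra.
have [q qy] := choice qP.
exists (\col_i q i, r) => //=; split=> [i|z zq].
  by have := qy i; rewrite mxE !in_itv/=; lra.
apply: yA; split => // i j; rewrite ord1 /ball /=.
have := zq i; have := qy i; rewrite mxE !in_itv/= => h1 h2.
by rewrite ltr_norml; lra.
Qed.

(** The Borel sets are generated by the open sets, not by the coordinates; the countable union of
    boxes bridges the two. *)
Lemma measurable_fun_cV d (T : measurableType d) n
    (X : T -> borel 'cV[R]_n) :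
  (forall i, measurable_fun [set: T] (fun w => X w i ord0)) ->
  measurable_fun [set: T] X.
Proof.
move=> mX; apply: (@measurability _ _ T (borel 'cV[R]_n) _ _ (@open 'cV[R]_n)) => //.
move=> _ [A oA <-]; rewrite setTI (open_bigcup_box oA) preimage_bigcup.
apply: countable_bigcupT_measurable => // -[q r] /=.
have [qA|nqA] := pselect (forall z : 'cV[R]_n, (forall i, z i ord0 \in
    `]ratr (q i ord0) - ratr r, ratr (q i ord0) + ratr r[) -> A z); last first.
  by rewrite (_ : _ @^-1` _ = set0) //; apply/seteqP; split=> // w [].
rewrite (_ : _ @^-1` _ = ~` \bigcup_i ~` ((fun w => X w i ord0) @^-1`
    `]ratr (q i ord0) - ratr r, ratr (q i ord0) + ratr r[%classic)); last first.
  rewrite setC_bigcup; apply/seteqP; split=> [w [h _] i _|w h].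
    by rewrite setCK; exact: h.
  by split=> // i; have := h i I; rewrite setCK.
apply: measurableC; apply: countable_bigcupT_measurable => // i.
by apply: measurableC; rewrite -[X in measurable X]setTI; exact: mX.
Qed.

End Borel.

(* [sigma_type X D] is [Omega] with the sigma-algebra [sigma_of D X]. *)
Definition sigma_gen {dO : measure_display} {Omega : measurableType dO}
    {dT : measure_display} {T : measurableType dT} {I : Type}
    (X : I -> Omega -> T) (D : set I) : set (set Omega) :=
  \bigcup_(i in D) preimage_set_system setT (X i) (@measurable dT T).

Definition sigma_type {dO : measure_display} {Omega : measurableType dO}
    {dT : measure_display} {T : measurableType dT} {I : Type}
    (X : I -> Omega -> T) (D : set I) : measurableType _ :=
  g_sigma_algebraType (sigma_gen X D).

Section SubSigmaAlgebra.
Context {dO : measure_display} {Omega : measurableType dO}.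
Context {dT : measure_display} {T : measurableType dT} {I : Type}.
Variable X : I -> Omega -> T.
Implicit Types D : set I.


Lemma measurable_fun_sigma_type D i : D i ->
  measurable_fun [set: sigma_type X D] (X i).
Proof.
move=> Di _ B mB; apply: sub_sigma_algebra.
by exists i => //; exists B.
Qed.

Lemma measurable_fun_sigma_typeS D D' d (U : measurableType d) (h : Omega -> U) :
  D `<=` D' -> measurable_fun [set: sigma_type X D] h ->
  measurable_fun [set: sigma_type X D'] h.
Proof.
move=> DD' mh _ B mB; apply: sub_smallest2r (mh measurableT _ mB).
- exact: smallest_sigma_algebra.
- by move=> A [i Di ?]; exists i => //; exact: DD'.
Qed.

Lemma measurable_sigma_typeW D A :
  (forall i, D i -> measurable_fun [set: Omega] (X i)) ->
  measurable (A : set (sigma_type X D)) -> measurable (A : set Omega).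
Proof.
move=> mX; apply: smallest_sub; first exact: sigma_algebra_measurable.
by move=> _ [i Di [B mB <-]]; exact: mX.
Qed.

Lemma measurable_fun_sigma_typeW D d (U : measurableType d) (h : Omega -> U) :
  (forall i, D i -> measurable_fun [set: Omega] (X i)) ->
  measurable_fun [set: sigma_type X D] h -> measurable_fun [set: Omega] h.
Proof.
by move=> mX mh _ B mB; apply: (measurable_sigma_typeW mX); exact: mh.
Qed.

End SubSigmaAlgebra.

(** * Independence *)

Section SubIndependence.
Context {dO : measure_display} {Omega : measurableType dO} {R : realType}.
Context {dT : measure_display} {T : measurableType dT} {I : choiceType}.
Variables (P : probability Omega R) (X : I -> Omega -> T) (J D : set I) (j0 : I).
Hypotheses (indX : mutually_independent P J X) (DJ : D `<=` J) (Jj0 : J j0).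
Hypotheses (nDj0 : ~ D j0).
Hypothesis mX : forall i, J i -> measurable_fun [set: Omega] (X i).

Let mXD i : D i -> measurable_fun [set: Omega] (X i).
Proof. by move=> /DJ /mX. Qed.

(** A pi-system generating [sigma_type X D], on which mutual independence can be applied
    directly. *)
Let cylinder : set (set (sigma_type X D)) :=
  [set A | exists s : seq I, exists B : I -> set T,
    [/\ (forall i, i \in s -> D i), (forall i, measurable (B i)) &
        A = \bigcap_(i in [set` s]) (X i @^-1` B i)]].

Let cylinder_setI : setI_closed cylinder.
Proof.
move=> _ _ [s [B [sD mB ->]]] [s' [B' [sD' mB' ->]]].
exists (s ++ s').
exists (fun i => (if i \in s then B i else setT) `&`
  (if i \in s' then B' i else setT)).
split=> [i|i|].
- by rewrite mem_cat => /orP[/sD|/sD'].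
- by apply: measurableI; case: ifP => _ //; exact: measurableT.
- apply/seteqP; split=> [w [h h'] i /= _|w h].
    split; first by case: ifPn => // /h.
    by case: ifPn => // /h'.
  split=> i /= is_.
    have := h i; rewrite /= mem_cat is_ => /(_ isT)[+ _] //.
  by have := h i; rewrite /= mem_cat is_ orbT => /(_ isT)[_ +].
Qed.

Let measurable_cylinder : @measurable _ (sigma_type X D) = <<s cylinder >>.
Proof.
apply/seteqP; split; apply: smallest_sub; try exact: smallest_sigma_algebra.
  move=> _ [i Di [B mB <-]]; apply: sub_sigma_algebra.
  exists [:: i]; exists (fun=> B); split=> //.
    by move=> k; rewrite inE => /eqP ->.
  rewrite setTI; apply/seteqP; split=> [w h k /=|w /(_ i)/=].
    by rewrite inE => /eqP ->.
  by apply; rewrite inE.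
move=> _ [s [B [sD mB ->]]]; rewrite bigcap_seq big_seq.
apply: bigsetI_measurable => i is_.
rewrite -[X in measurable X]setTI.
exact: (@measurable_fun_sigma_type _ _ _ _ _ X D i (sD _ is_) measurableT _ (mB i)).
Qed.

(** Dynkin's pi-lambda argument with [B] fixed: the product rule holds on cylinders and survives
    complements and countable disjoint unions. *)
Lemma sigma_type_independent (A : set (sigma_type X D)) (B : set T) :
  measurable A -> measurable B ->
  P (A `&` X j0 @^-1` B) = (P A * P (X j0 @^-1` B))%E.
Proof.
move=> + mB; rewrite {1}measurable_cylinder; move: A.
have mXB : measurable (X j0 @^-1` B).
  by rewrite -[X in measurable X]setTI; exact: mX.
have mO (S : set Omega) : measurable (S : set (sigma_type X D)) -> measurable S.
  exact: measurable_sigma_typeW.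
apply: (@dynkin_induction _ (sigma_type X D) cylinder
  (fun A => P (A `&` X j0 @^-1` B) = (P A * P (X j0 @^-1` B))%E)) => //.
- by rewrite setTI probability_setT mul1e.
- move=> _ [s [C [sD mC ->]]].
  have sE : [set` s] = [set` undup s].
    by apply/seteqP; split=> i /=; rewrite mem_undup.
  have nj0 : j0 \notin undup s.
    by apply/negP; rewrite mem_undup => /sD.
  rewrite sE bigcap_seq.
  (* [B] at [j0] and [C] elsewhere; there is no clash, as [j0] lies outside [D]. *)
  pose C' i := if i == j0 then B else C i.
  have mC' i : measurable (C' i) by rewrite /C'; case: ifP.
  have C'E : forall i, i \in undup s -> C' i = C i.
    by move=> i is_; rewrite /C'; case: eqP => // ij; move: nj0; rewrite -ij is_.
  have := indX (s := j0 :: undup s) (B := C') _ _ mC'.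
  rewrite /= nj0 undup_uniq => /(_ isT).
  rewrite !big_cons {1 3}/C' eqxx.
  rewrite (eq_big_seq (fun i => X i @^-1` C i)); last by move=> i /C'E ->.
  rewrite [X in (_ * X)%E](eq_big_seq (fun i => P (X i @^-1` C i))); last first.
    by move=> i /C'E ->.
  rewrite setIC => ->; last first.
    by move=> i; rewrite inE mem_undup => /orP[/eqP -> //|/sD /DJ].
  rewrite muleC (indX (s := undup s)) ?undup_uniq// => i.
  by rewrite mem_undup => /sD /DJ.
- move=> S /mO mS PS.
  rewrite setIC -setDE measureD//; last first.
    by rewrite (le_lt_trans (probability_le1 P _)) ?ltry.
  rewrite (setIC (X j0 @^-1` B) S) [X in (_ - X)%E]PS probability_setC//.
  by rewrite muleBl ?mul1e// fin_num_measure.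
- move=> F mF tF PF.
  have mF' n : measurable (F n : set Omega) by exact: mO.
  rewrite setI_bigcupl measure_bigcup//; last 2 first.
    by move=> k _; exact: measurableI.
    exact: trivIset_setIr.
  rewrite measure_bigcup//.
  rewrite -(fineK (fin_num_measure P _ mXB)) muleC -nneseriesZl//.
  rewrite fineK ?fin_num_measure//; apply: eq_eseriesr => k _.
  by rewrite muleC; exact: PF.
Qed.

End SubIndependence.

(** Change of variables without integrability, through positive and negative parts: below it is
    applied to sections at every outcome, not only where they are integrable. *)
Lemma integral_distributionE d d' (T : measurableType d) (T' : measurableType d')
    (R : realType) (P : probability T R) (X : {mfun T >-> T'}) (f : T' -> \bar R) :
  measurable_fun [set: T'] f ->
  (\int[distribution P X]_y f y = \int[P]_x f (X x))%E.
Proof.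
move=> mf; rewrite integralE [RHS]integralE.
rewrite -/(f \o X) [in RHS]funepos_comp [in RHS]funeneg_comp.
congr (_ - _)%E; rewrite ge0_integral_distribution//.
- exact: measurable_funepos.
- exact: measurable_funeneg.
Qed.

(** * Freezing one of two independent random elements *)

Section IndependentFubini.
Context {dO : measure_display} {Omega : measurableType dO} {R : realType}.
Context {d1 d2 : measure_display} {S : measurableType d1} {T : measurableType d2}.
Variables (P : probability Omega R) (Y : Omega -> S) (Z : Omega -> T).
Hypotheses (mY : measurable_fun [set: Omega] Y) (mZ : measurable_fun [set: Omega] Z).
Hypothesis indYZ : forall A B, measurable A -> measurable B ->
  P (Y @^-1` A `&` Z @^-1` B) = (P (Y @^-1` A) * P (Z @^-1` B))%E.

Let YZ (w : Omega) : S * T := (Y w, Z w).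

Let mYZ : measurable_fun [set: Omega] YZ.
Proof. exact: measurable_fun_pair. Qed.

HB.instance Definition _ := isMeasurableFun.Build _ _ _ _ _ mY.
HB.instance Definition _ := isMeasurableFun.Build _ _ _ _ _ mZ.
HB.instance Definition _ := isMeasurableFun.Build _ _ _ _ _ mYZ.

Let law_pair (A : set (S * T)) : measurable A ->
  (distribution P Y \x distribution P Z)%E A = distribution P YZ A.
Proof. by apply: product_measure_unique => B C mB mC; exact: indYZ. Qed.

Let integral_law (phi : S * T -> \bar R) :
  (\int[distribution P YZ]_z phi z =
   \int[(distribution P Y \x distribution P Z)%E]_z phi z)%E.
Proof.
by apply: eq_measure_integral => A mA _; apply/esym; exact: law_pair.
Qed.

(** The joint law is the product law, so Tonelli applies. The inner integral is carried back to
    [Omega] with [Y w] frozen, as in [AS2]. *)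
Lemma ge0_integral_independent (phi : S * T -> \bar R) :
  measurable_fun [set: S * T] phi -> (forall z, 0 <= phi z)%E ->
  measurable_fun [set: Omega] (fun w => \int[P]_w' phi (Y w, Z w'))%E /\
  (\int[P]_w phi (Y w, Z w) = \int[P]_w \int[P]_w' phi (Y w, Z w'))%E.
Proof.
move=> mphi phi0.
have FE : (fun w => \int[P]_w' phi (Y w, Z w'))%E =
    fubini_F (distribution P Z) phi \o Y.
  apply/funext => w /=; rewrite /fubini_F integral_distributionE//.
  exact: measurableT_comp.
have mF := measurable_fun_fubini_tonelli_F (m2 := distribution P Z) phi mphi phi0.
rewrite FE; split; first exact: measurableT_comp.
transitivity (\int[distribution P YZ]_z phi z)%E.
  by rewrite integral_distributionE.
by rewrite integral_law fubini_tonelli1// integral_distributionE.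
Qed.

Lemma integral_independent (phi : S * T -> \bar R) :
  measurable_fun [set: S * T] phi ->
  P.-integrable [set: Omega] (fun w => phi (Y w, Z w)) ->
  measurable_fun [set: Omega] (fun w => \int[P]_w' phi (Y w, Z w'))%E /\
  (\int[P]_w phi (Y w, Z w) = \int[P]_w \int[P]_w' phi (Y w, Z w'))%E.
Proof.
move=> mphi iphi.
have iphi' : (distribution P Y \x distribution P Z)%E.-integrable setT phi.
  apply/integrableP; split => //; rewrite -integral_law.
  by have /integrableP[] := integrable_pushforward mYZ mphi iphi measurableT.
have FE : (fun w => \int[P]_w' phi (Y w, Z w'))%E =
    fubini_F (distribution P Z) phi \o Y.
  apply/funext => w /=; rewrite /fubini_F integral_distributionE//.
  exact: measurableT_comp.
have mF := measurable_fubini_F iphi'; rewrite FE; split.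
  exact: measurableT_comp.
transitivity (\int[distribution P YZ]_z phi z)%E.
  by rewrite integral_distribution.
by rewrite integral_law -integral12_prod_meas1// integral_distributionE.
Qed.

(** Once [Y w] is frozen, [c (Y w)] is a constant that leaves the inner integral, which vanishes for
    almost every [w]. *)
Lemma integral_independent_centered (c : S -> R) (e : S * T -> R) :
  measurable_fun [set: S] c -> measurable_fun [set: S * T] e ->
  P.-integrable [set: Omega] (fun w => (c (Y w) * e (Y w, Z w))%:E) ->
  {ae P, forall w, P.-integrable [set: Omega] (fun w' => (e (Y w, Z w'))%:E) /\
     (\int[P]_w' (e (Y w, Z w'))%:E = 0)%E} ->
  (\int[P]_w (c (Y w) * e (Y w, Z w))%:E = 0)%E.
Proof.
move=> mc me ice e0.
pose phi (z : S * T) := (c z.1 * e z)%:E.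
have mphi : measurable_fun [set: S * T] phi.
  apply/measurable_EFinP; apply: measurable_funM => //.
  exact: measurableT_comp mc measurable_fst.
have [mF ->] := integral_independent mphi ice.
rewrite -(integral0 P setT); apply: ae_eq_integral => //.
apply: filterS e0 => w [ie ie0] _ /=.
rewrite /phi /=; under eq_integral do rewrite EFinM.
by rewrite integralZl// ie0 mule0.
Qed.

End IndependentFubini.

(** * Integrable and square-integrable functions *)

Section RealIntegrals.
Context {d : measure_display} {T : measurableType d} {R : realType}.
Variable P : probability T R.
Implicit Types u v h : T -> R.

Definition intg h : Prop := P.-integrable [set: T] (EFin \o h).

Definition sqint h : Prop :=
  measurable_fun [set: T] h /\ intg (fun w => h w ^+ 2).

Lemma intg_measurable h : intg h -> measurable_fun [set: T] h.
Proof. by move=> /measurable_int/measurable_EFinP. Qed.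

Lemma intg_cst (a : R) : intg (fun=> a).
Proof. exact: finite_measure_integrable_cst. Qed.

Lemma intgD u v : intg u -> intg v -> intg (fun w => u w + v w).
Proof. by move=> iu iv; have := integrableD measurableT iu iv. Qed.

Lemma intgZ (a : R) u : intg u -> intg (fun w => a * u w).
Proof. by move=> iu; have := integrableZl measurableT a iu. Qed.

Lemma intg_sum (I : Type) (r : seq I) (F : I -> T -> R) :
  (forall i, intg (F i)) -> intg (fun w => \sum_(i <- r) F i w).
Proof.
move=> iF; have := integrable_sum measurableT r (P := xpredT) (fun i _ => iF i).
by congr (is_true (integrable _ _ _)); apply/funext => w /=; rewrite sumEFin.
Qed.

Lemma intg_le u v : measurable_fun [set: T] u -> intg v ->
  (forall w, `|u w| <= v w) -> intg u.
Proof.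
move=> mu iv uv; apply: le_integrable iv => //; first exact/measurable_EFinP.
by move=> w _ /=; rewrite lee_fin (le_trans (uv w)) ?ler_norm.
Qed.

Lemma intg_ae_le u v : measurable_fun [set: T] u -> intg v ->
  (forall w, 0 <= u w) -> (forall w, 0 <= v w) ->
  {ae P, forall w, u w <= v w} -> intg u.
Proof.
move=> mu iv u0 v0 uv; apply/integrableP; split; first exact/measurable_EFinP.
have /integrableP[mv voo] := iv.
apply: le_lt_trans voo; apply: ae_ge0_le_integral => //.
- by apply: measurableT_comp => //; exact/measurable_EFinP.
- by apply: measurableT_comp.
- by apply: filterS uv => w uvw _ /=; rewrite !ger0_norm ?lee_fin.
Qed.

(** The lower bound makes the negative part finite; the upper bound on the integral then makes the
    positive part finite. *)
Lemma intg_lower_bound h (a M : R) : measurable_fun [set: T] h ->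
  (forall w, a <= h w) -> (\int[P]_w (h w)%:E <= M%:E)%E -> intg h.
Proof.
move=> mh ah hM.
have mh' : measurable_fun [set: T] (EFin \o h) by exact/measurable_EFinP.
have hn : (\int[P]_w (EFin \o h)^\- w <= `|a|%:E)%E.
  have -> : `|a|%:E = (\int[P]_w (cst `|a|%:E) w)%E.
    by rewrite integral_cst// [X in (_ * X)%E]probability_setT mule1.
  apply: ge0_le_integral => //; first exact: measurable_funeneg.
  move=> w _; rewrite funenegE /= -EFin_max lee_fin ge_max normr_ge0 andbT.
  by rewrite (le_trans (_ : _ <= - a)) ?lerN2// -normrN ler_norm.
have hnfin : (\int[P]_w (EFin \o h)^\- w)%E \is a fin_num.
  rewrite ge0_fin_numE; first exact: le_lt_trans hn (ltry _).
  exact: integral_ge0.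
move: hM; rewrite integralE leeBlDr// => hp.
apply/integrableP; split=> //.
rewrite (eq_integral (fun w => (EFin \o h)^\+ w + (EFin \o h)^\- w)%E); last first.
  by move=> w _; have := congr1 (fun F => F w) (fune_abse (EFin \o h)).
rewrite ge0_integralD//; [|exact: measurable_funepos|exact: measurable_funeneg].
rewrite lte_add_pinfty//; last exact: le_lt_trans hn (ltry _).
apply: le_lt_trans hp _; rewrite lte_add_pinfty ?ltry//.
exact: le_lt_trans hn (ltry _).
Qed.

Lemma intgM u v : sqint u -> sqint v -> intg (fun w => u w * v w).
Proof.
move=> [mu iu] [mv iv].
apply: (@intg_le _ (fun w => u w ^+ 2 + v w ^+ 2)).
- exact: measurable_funM.
- exact: intgD.
- move=> w; move: (u w) (v w) => a b; rewrite ler_norml.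
  move: (sqr_ge0 (a + b)) (sqr_ge0 (a - b)) (sqr_ge0 a) (sqr_ge0 b).
  by move=> h1 h2 h3 h4; apply/andP; split; lra.
Qed.

Lemma sqintD u v : sqint u -> sqint v -> sqint (fun w => u w + v w).
Proof.
move=> su sv; split; first exact: measurable_funD su.1 sv.1.
have := intgD (intgD su.2 (intgZ 2 (intgM su sv))) sv.2.
by congr intg; apply/funext => w; ring.
Qed.

Lemma sqint_cst (a : R) : sqint (fun=> a).
Proof. by split; [exact: measurable_cst|exact: intg_cst]. Qed.

Lemma sqint_intg u : sqint u -> intg u.
Proof.
move=> su; have := intgM su (sqint_cst 1).
by congr intg; apply/funext => w; rewrite mulr1.
Qed.

Lemma sqintZ (a : R) u : sqint u -> sqint (fun w => a * u w).
Proof.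
move=> su; split; first exact: measurable_funM (measurable_cst _) su.1.
by have := intgZ (a ^+ 2) su.2; congr intg; apply/funext => w; ring.
Qed.

Lemma sqint_sum (I : Type) (r : seq I) (F : I -> T -> R) :
  (forall i, sqint (F i)) -> sqint (fun w => \sum_(i <- r) F i w).
Proof.
move=> sF; elim: r => [|i r IH].
  by under eq_fun do rewrite big_nil; exact: sqint_cst.
by under eq_fun do rewrite big_cons; exact: sqintD.
Qed.

Lemma EFin_Rintegral u : intg u -> (\int[P]_w (u w)%:E)%E = (\int[P]_w u w)%:E.
Proof. by move=> iu; rewrite fineK//; exact: integrable_fin_num. Qed.

Lemma integralB_cst h (a : R) : intg (fun w => h w - a) ->
  (\int[P]_w (h w)%:E = a%:E)%E -> (\int[P]_w (h w - a)%:E = 0)%E.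
Proof.
move=> iha ha.
have ih : intg h.
  by have := intgD iha (intg_cst a); congr intg; apply/funext => w; rewrite subrK.
rewrite EFin_Rintegral// RintegralB//; last exact: intg_cst.
rewrite /Rintegral ha integral_cst// [X in (_ * X)%E]probability_setT mule1.
by rewrite subrr.
Qed.

Lemma Rintegral_sum (I : Type) (r : seq I) (F : I -> T -> R) :
  (forall i, intg (F i)) ->
  \int[P]_w (\sum_(i <- r) F i w) = \sum_(i <- r) \int[P]_w F i w.
Proof.
move=> iF; elim: r => [|i r IH].
  under eq_Rintegral do rewrite big_nil.
  by rewrite Rintegral_cst// mul0r big_nil.
under eq_Rintegral do rewrite big_cons.
by rewrite RintegralD// ?IH ?big_cons//; [exact: iF|exact: intg_sum].
Qed.

Lemma Rintegral_ge0_ae u : intg u -> {ae P, forall w, 0 <= u w} ->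
  0 <= \int[P]_w u w.
Proof.
move=> iu u0; rewrite (_ : \int[P]_w u w = \int[P]_w `|u w|).
  by apply: Rintegral_ge0 => w _; exact: normr_ge0.
congr fine; apply: ae_eq_integral => //.
- exact: measurable_int iu.
- by apply/measurable_EFinP/measurableT_comp => //; exact: intg_measurable.
- by apply: filterS u0 => w u0 _; rewrite ger0_norm.
Qed.

Lemma le_Rintegral_ae u v : intg u -> intg v ->
  {ae P, forall w, u w <= v w} -> \int[P]_w u w <= \int[P]_w v w.
Proof.
move=> iu iv uv; rewrite -subr_ge0 -RintegralB//; apply: Rintegral_ge0_ae.
  by have := integrableB measurableT iv iu.
by apply: filterS uv => w; rewrite subr_ge0.
Qed.

End RealIntegrals.

(** * One iteration *)

Lemma grad_measurable (R : realType) (n : nat) (f : 'cV[R]_n -> R) (l : 'I_n) :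
  continuously_differentiable f ->
  measurable_fun [set: borel 'cV[R]_n] (fun x : 'cV[R]_n => grad f x l ord0).
Proof.
move=> [_ cf].
have -> : (fun x : 'cV[R]_n => grad f x l ord0) = 'D_(delta_mx l ord0) f.
  by apply/funext => x; rewrite mxE.
exact: (@continuous_borel_measurable R 'cV[R]_n).
Qed.

Section SqnStep.
Context {R : realType} {n d m : nat}.
Context {dO : measure_display} {Omega : measurableType dO}.
Variables (P : probability Omega R) (mu : probability (borel 'cV[R]_d) R).
Variable g : 'cV[R]_n -> 'cV[R]_d -> 'cV[R]_n.
Variable xi : nat -> 'I_m -> Omega -> borel 'cV[R]_d.
Variable x : nat -> Omega -> borel 'cV[R]_n.
Variable H : nat -> Omega -> 'M[R]_n.
Variables (x1 : 'cV[R]_n) (H1 : 'M[R]_n) (alpha : nat -> R).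
Variables (f : 'cV[R]_n -> R) (L flow sigma kl ku : R).
Hypotheses (L_gt0 : 0 < L) (kl_gt0 : 0 < kl) (ku_gt0 : 0 < ku) (m_gt0 : (0 < m)%N).
Hypothesis alpha_ge0 : forall k, 0 <= alpha k.
Hypothesis iter : sqn_iteration P g (m := fun=> m) xi x H mu alpha x1 H1.
Hypotheses (as1 : AS1 f L flow) (as2 : AS2 P g (m := fun=> m) xi x f sigma).
Hypotheses (as3 : AS3 P H kl ku) (as4 : AS4 (m := fun=> m) xi H).

Let index := {k : nat & 'I_m}.
Let X : index -> Omega -> borel 'cV[R]_d := samples (m := fun=> m) xi.
Let past k : set index := [set j | (0 < tag j < k)%N].
Let idx k (i : 'I_m) : index := @Tagged nat k (fun=> 'I_m) i.
(** Contains the whole past and the rest of batch [k], so it serves both for centering given the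
    past and for correlations within the batch. *)
Let others k i : set index := [set j | (0 < tag j <= k)%N /\ j <> idx k i].

Let past_le k k' : (k <= k')%N -> past k `<=` past k'.
Proof.
move=> kk' j /andP[j0 jk]; apply/andP; split => //.
exact: leq_trans kk'.
Qed.

Let mX j : (0 < tag j)%N -> measurable_fun [set: Omega] (X j).
Proof.
by move=> j0; have [_ mxi _ _ _] := iter; exact: (mxi _ _ j0).1.
Qed.

Let g_comp D (u : Omega -> borel 'cV[R]_n) (z : Omega -> borel 'cV[R]_d) l :
  measurable_fun [set: sigma_type X D] u -> measurable_fun [set: sigma_type X D] z ->
  measurable_fun [set: sigma_type X D] (fun w => g (u w) (z w) l ord0).
Proof.
move=> mu' mz; have [mg _ _ _ _] := iter.
exact: measurableT_comp (coord_measurable l ord0)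
  (measurableT_comp mg (measurable_fun_pair mu' mz)).
Qed.

(** [past 1] is empty, so at [k = 1] the constancy of the initial matrix is what is needed; [AS4]
    covers the later indices. *)
Lemma H_measurable k i j : (0 < k)%N ->
  measurable_fun [set: sigma_type X (past k)] (fun w => H k w i j).
Proof.
case: k => // -[_|k _].
  have [_ _ [_ H1E] _ _] := iter.
  rewrite (_ : (fun w => _) = fun=> H1 i j); last by apply/funext => w; rewrite H1E.
  exact: measurable_cst.
apply: (measurableT_comp (coord_measurable i j)) => _ B mB.
by apply: as4 => //; exists B.
Qed.

Lemma batch_gradient_measurable k l : (0 < k)%N ->
  measurable_fun [set: sigma_type X (past k)] (x k) ->
  measurable_fun [set: sigma_type X (past k.+1)]
    (fun w => batch_gradient g (m := fun=> m) xi x k w l ord0).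
Proof.
move=> k0 mx; rewrite /batch_gradient.
under eq_fun do rewrite mxE summxE.
apply: measurable_funM; first exact: measurable_cst.
apply: measurable_sum => i; apply: g_comp.
  by apply: measurable_fun_sigma_typeS mx; exact: past_le.
apply: (@measurable_fun_sigma_type _ _ _ _ _ X (past k.+1) (idx k i)).
by apply/andP; split => /=.
Qed.

Lemma x_measurable k : (0 < k)%N -> measurable_fun [set: sigma_type X (past k)] (x k).
Proof.
have [_ _ [x1E _] _ xS] := iter.
case: k => // k _; elim: k => [|k IH].
  rewrite (_ : x 1%N = fun=> x1); last by apply/funext => w; rewrite x1E.
  exact: measurable_cst.
apply: measurable_fun_cV => l.
have pS := past_le (leqnSn k.+1).
rewrite (_ : (fun w => _) = (fun w => x k.+1 w l ord0 - alpha k.+1 *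
    (\sum_j H k.+1 w l j * batch_gradient g (m := fun=> m) xi x k.+1 w j ord0)));
  last by apply/funext => w; rewrite xS// !mxE.
apply: measurable_funB.
  apply: (measurable_fun_sigma_typeS pS).
  exact: measurableT_comp (coord_measurable l ord0) IH.
apply: measurable_funM; first exact: measurable_cst.
apply: measurable_sum => j; apply: measurable_funM.
  by apply: (measurable_fun_sigma_typeS pS); exact: H_measurable.
exact: batch_gradient_measurable.
Qed.

Definition noise k i l w : R :=
  g (x k w) (@xi k i w) l ord0 - grad f (x k w) l ord0.

(** The noise as a function of an outcome, which fixes the iterate, and of a separate sample value.
    [D] only selects the sigma-algebra on the outcomes. *)
Let noise_fun k l (D : set index) (z : sigma_type X D * borel 'cV[R]_d) : R :=
  g (x k z.1) z.2 l ord0 - grad f (x k z.1) l ord0.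

Let past_others k i : past k `<=` others k i.
Proof.
move=> j /andP[j0 jk]; split; first by rewrite j0 ltnW.
by move=> ji; move: jk; rewrite ji /= ltnn.
Qed.

Let measurable_noise_fun k l D : (0 < k)%N -> past k `<=` D ->
  measurable_fun [set: sigma_type X D * borel 'cV[R]_d] (@noise_fun k l D).
Proof.
move=> k0 pD; have [mg _ _ _ _] := iter; have [cdf _ _] := as1.
have mx : measurable_fun [set: sigma_type X D * borel 'cV[R]_d]
    (fun z => x k z.1 : borel 'cV[R]_n).
  exact: measurableT_comp (measurable_fun_sigma_typeS pD (x_measurable k0))
    measurable_fst.
apply: measurable_funB.
  apply: measurableT_comp (coord_measurable l ord0) _.
  exact: measurableT_comp mg (measurable_fun_pair mx measurable_snd).
exact: measurableT_comp (grad_measurable l cdf) mx.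
Qed.

Let mothers k i j : others k i j -> measurable_fun [set: Omega] (X j).
Proof. by move=> [/andP[j0 _] _]; exact: mX. Qed.

(** The identity as a random element of the coarser space: the [Y] of the freezing lemmas. *)
Let to_sigma_type D (w : Omega) : sigma_type X D := w.

Let measurable_to_sigma_type k i : measurable_fun [set: Omega] (@to_sigma_type (others k i)).
Proof.
move=> _ A mA; rewrite setTI.
by apply: measurable_sigma_typeW mA => j; exact: mothers.
Qed.

Let independent_others k i (A : set (sigma_type X (others k i)))
    (B : set (borel 'cV[R]_d)) :
  (0 < k)%N -> measurable A -> measurable B ->
  P (@to_sigma_type (others k i) @^-1` A `&` @xi k i @^-1` B) =
  (P (@to_sigma_type (others k i) @^-1` A) * P (@xi k i @^-1` B))%E.
Proof.
move=> k0 mA mB; have [indX _ _ _] := as2.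
apply: (@sigma_type_independent _ _ _ _ _ _ P X [set j | (0 < tag j)%N] (others k i)
  (idx k i)) => //.
- by move=> j [/andP[]].
- by move=> [].
Qed.

Let measurable_noise_at k i l (w : Omega) : (0 < k)%N ->
  measurable_fun [set: Omega]
    (fun w' => @noise_fun k l (others k i) (w, @xi k i w')).
Proof.
move=> k0.
have mp : measurable_fun [set: Omega]
    (fun w' => (to_sigma_type (others k i) w, @xi k i w')).
  apply: measurable_fun_pair; first exact: measurable_cst.
  exact: (mX (j := idx k i)).
exact: measurableT_comp (measurable_noise_fun l k0 (@past_others k i)) mp.
Qed.

Lemma noise_measurable k i l : (0 < k)%N ->
  measurable_fun [set: Omega] (noise k i l).
Proof.
move=> k0.
have mp : measurable_fun [set: Omega]
    (fun w => (to_sigma_type (others k i) w, @xi k i w)).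
  apply: measurable_fun_pair; first exact: measurable_to_sigma_type.
  exact: (mX (j := idx k i)).
exact: measurableT_comp (measurable_noise_fun l k0 (@past_others k i)) mp.
Qed.

Let integral_noise_le k i : (0 < k)%N ->
  (\int[P]_w (\sum_l noise k i l w ^+ 2)%:E <= (sigma ^+ 2)%:E)%E.
Proof.
move=> k0; have [_ _ _ var] := as2.
pose s (z : sigma_type X (others k i) * borel 'cV[R]_d) : \bar R :=
  (\sum_l noise_fun k l z ^+ 2)%:E.
have ms : measurable_fun [set: sigma_type X (others k i) * borel 'cV[R]_d] s.
  apply/measurable_EFinP; apply: measurable_sum => l.
  by apply: measurable_funX; apply: measurable_noise_fun => //; exact: past_others.
have s0 z : (0 <= s z)%E by rewrite lee_fin sumr_ge0// => l _; exact: sqr_ge0.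
have [mF ->] := ge0_integral_independent (@measurable_to_sigma_type k i)
  (mX (j := idx k i) k0) (fun A B => @independent_others k i A B k0) ms s0.
have -> : (sigma ^+ 2)%:E = (\int[P]_w (cst (sigma ^+ 2)%:E) w)%E.
  by rewrite integral_cst// [X in (_ * X)%E]probability_setT mule1.
apply: ae_ge0_le_integral => //.
- by move=> w _; exact: integral_ge0.
- by move=> w _; rewrite lee_fin sqr_ge0.
- apply: filterS (var k i k0) => w + _ /=; rewrite expectation.unlock.
  apply: le_trans; rewrite le_eqVlt; apply/orP; left; apply/eqP.
  apply: eq_integral => w' _; rewrite /s enorm_sqr dotE; congr EFin.
  by apply: eq_bigr => l _; rewrite /noise_fun !mxE expr2.
Qed.

Lemma noise_sqint k i l : (0 < k)%N -> sqint P (noise k i l).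
Proof.
move=> k0; split; first exact: noise_measurable.
apply: (@intg_le _ _ _ _ _ (fun w => \sum_l noise k i l w ^+ 2)).
- by apply: measurable_funX; exact: noise_measurable.
- apply/integrableP; split.
    apply/measurable_EFinP; apply: measurable_sum => j.
    by apply: measurable_funX; exact: noise_measurable.
  apply: le_lt_trans (ltry (sigma ^+ 2)); apply: le_trans (integral_noise_le i k0).
  rewrite le_eqVlt; apply/orP; left; apply/eqP; apply: eq_integral => w _ /=.
  by rewrite ger0_norm// sumr_ge0// => j _; exact: sqr_ge0.
- move=> w; rewrite ger0_norm ?sqr_ge0// (bigD1 l)//= lerDl.
  by rewrite sumr_ge0// => j _; exact: sqr_ge0.
Qed.

Lemma noise_var k i : (0 < k)%N ->
  \sum_l \int[P]_w (noise k i l w ^+ 2) <= sigma ^+ 2.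
Proof.
move=> k0; have si l := (noise_sqint i l k0).2.
rewrite -Rintegral_sum// -lee_fin -EFin_Rintegral; last exact: intg_sum.
exact: integral_noise_le.
Qed.

(** Freezing everything but sample [(k, i)] makes [c] constant and leaves the oracle's mean error,
    which is zero. *)
Lemma noise_orth k i l (c : Omega -> R) : (0 < k)%N ->
  measurable_fun [set: sigma_type X (others k i)] c -> sqint P c ->
  \int[P]_w (c w * noise k i l w) = 0.
Proof.
move=> k0 mc sc; have [_ _ mean var] := as2.
rewrite /Rintegral (_ : (\int[P]_w _ = 0)%E)//.
have me := measurable_noise_fun l k0 (@past_others k i).
apply: (@integral_independent_centered _ _ _ _ _ _ _ P _ _ (@measurable_to_sigma_type k i)
  (mX (j := idx k i) k0) (fun A B => @independent_others k i A B k0) c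
  (@noise_fun k l (others k i)) mc me).
- exact: intgM sc (noise_sqint i l k0).
- move: (mean k i k0) (var k i k0); apply: filterS2 => w.
  move=> meanw varw; move: (meanw l) varw.
  rewrite !expectation.unlock => {}meanw varw.
  (* For almost every frozen [w], the variance clause makes the section square-integrable, hence
     integrable, so that its mean can be subtracted. *)
  have su : sqint P
      (fun w' => noise_fun k l (to_sigma_type (others k i) w, @xi k i w')).
    split; first exact: measurable_noise_at.
    apply: (@intg_le _ _ _ _ _ (fun w' =>
        \sum_j noise_fun k j (to_sigma_type (others k i) w, @xi k i w') ^+ 2)).
    + by apply: measurable_funX; exact: measurable_noise_at.
    + apply/integrableP; split.
        apply/measurable_EFinP; apply: measurable_sum => j.
        by apply: measurable_funX; exact: measurable_noise_at.
      apply: le_lt_trans (ltry (sigma ^+ 2)); apply: le_trans varw.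
      rewrite le_eqVlt; apply/orP; left; apply/eqP; apply: eq_integral => w' _ /=.
      rewrite ger0_norm; last by rewrite sumr_ge0// => j _; exact: sqr_ge0.
      rewrite enorm_sqr dotE; congr EFin.
      by apply: eq_bigr => j _; rewrite /noise_fun !mxE expr2.
    + move=> w'; rewrite ger0_norm ?sqr_ge0// (bigD1 l)//= lerDl.
      by rewrite sumr_ge0// => j _; exact: sqr_ge0.
  split; first exact: (sqint_intg su).
  exact: (@integralB_cst _ _ _ P (fun w' => g (x k w) (@xi k i w') l ord0)
    (grad f (x k w) l ord0) (sqint_intg su) meanw).
Qed.

(** * Second moments and expected decrease *)

Variable Mf : R.
Hypothesis fMf : forall k, (0 < k)%N -> ('E_P[fun w => f (x k w)] <= Mf%:E)%E.

Let grad_meas k l D : (0 < k)%N -> past k `<=` D ->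
  measurable_fun [set: sigma_type X D] (fun w => grad f (x k w) l ord0).
Proof.
move=> k0 pD; have [cdf _ _] := as1.
exact: measurableT_comp (grad_measurable l cdf)
  (measurable_fun_sigma_typeS pD (x_measurable k0)).
Qed.

Let toT D (h : Omega -> R) : D `<=` [set j | (0 < tag j)%N] ->
  measurable_fun [set: sigma_type X D] h -> measurable_fun [set: Omega] h.
Proof.
by move=> D0 mh; apply: measurable_fun_sigma_typeW mh => j /D0; exact: mX.
Qed.

Let past_pos k : past k `<=` [set j | (0 < tag j)%N].
Proof. by move=> j /andP[]. Qed.

Lemma f_intg k : (0 < k)%N -> intg P (fun w => f (x k w)).
Proof.
move=> k0; have [[df _] flowf _] := as1.
apply: (@intg_lower_bound _ _ _ _ _ flow Mf) => //.
- apply: toT (@past_pos k) _.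
  apply: measurableT_comp _ (x_measurable k0).
  apply: (@continuous_borel_measurable R 'cV[R]_n) => z.
  exact: differentiable_continuous.
- by have := fMf k0; rewrite expectation.unlock.
Qed.

(** The squared gradient is dominated by [2 L (f - flow)], integrable along the iterates. *)
Lemma grad_sqint k l : (0 < k)%N -> sqint P (fun w => grad f (x k w) l ord0).
Proof.
move=> k0; have mg := toT (@past_pos k) (grad_meas l k0 (@subset_refl _ (past k))).
split=> //; apply: (@intg_le _ _ _ _ _ (fun w => 2 * L * (f (x k w) + - flow))).
- exact: measurable_funX.
- by apply: intgZ; apply: intgD; [exact: f_intg|exact: intg_cst].
- move=> w; rewrite ger0_norm ?sqr_ge0//.
  apply: le_trans (grad_sqr_le (x k w) as1 L_gt0).
  rewrite dotE (bigD1 l)//= -expr2 lerDl.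
  by rewrite sumr_ge0// => j _; rewrite -expr2 sqr_ge0.
Qed.

Let dot_grad_intg k : (0 < k)%N ->
  intg P (fun w => dot (grad f (x k w)) (grad f (x k w))).
Proof.
move=> k0; under eq_fun do rewrite dotE.
by apply: intg_sum => l; apply: intgM; exact: grad_sqint.
Qed.

Lemma Hgrad_sqint k l : (0 < k)%N ->
  sqint P (fun w => (H k w *m grad f (x k w)) l ord0).
Proof.
move=> k0; have [_ _ _ posH _] := iter.
have mHg j : measurable_fun [set: Omega] (fun w => (H k w *m grad f (x k w)) j ord0).
  under eq_fun do rewrite mxE.
  apply: measurable_sum => i; apply: measurable_funM.
    by apply: toT (@past_pos k) _; exact: H_measurable.
  by apply: toT (@past_pos k) _; exact: grad_meas.
split=> //.
apply: (@intg_ae_le _ _ _ _ _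
    (fun w => ku ^+ 2 * dot (grad f (x k w)) (grad f (x k w)))).
- exact: measurable_funX.
- by apply: intgZ; exact: dot_grad_intg.
- by move=> w; exact: sqr_ge0.
- by move=> w; rewrite mulr_ge0 ?sqr_ge0 ?dotvv_ge0.
- apply: filterS (as3 k0) => w [klH Hku].
  have [sH _] := posH k w k0.
  apply: le_trans (loewner_mulmx_le _ ku_gt0 sH _ Hku); last first.
    move=> u; apply: le_trans (loewner_ge_dot u klH).
    by rewrite mulr_ge0 ?dotvv_ge0// ltW.
  rewrite dotE (bigD1 l)//= -expr2 lerDl.
  by rewrite sumr_ge0// => j _; rewrite -expr2 sqr_ge0.
Qed.

Definition batch_noise k w : 'cV[R]_n :=
  batch_gradient g (m := fun=> m) xi x k w - grad f (x k w).

Let m_neq0 : m%:R != 0 :> R.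
Proof. by rewrite pnatr_eq0 -lt0n. Qed.

Lemma batch_noiseE k w l :
  batch_noise k w l ord0 = m%:R^-1 * \sum_i noise k i l w.
Proof.
rewrite /noise sumrB mulrBr sumr_const card_ord.
rewrite -(mulr_natl (grad f (x k w) l ord0)) mulKf//.
by rewrite /batch_noise /batch_gradient !mxE summxE.
Qed.

Let batch_noise_sqint k l : (0 < k)%N -> sqint P (fun w => batch_noise k w l ord0).
Proof.
move=> k0; under eq_fun do rewrite batch_noiseE.
apply: sqintZ; apply: sqint_sum => i; exact: noise_sqint.
Qed.

Lemma batch_noise_orth k l (c : Omega -> R) : (0 < k)%N ->
  measurable_fun [set: sigma_type X (past k)] c -> sqint P c ->
  \int[P]_w (c w * batch_noise k w l ord0) = 0.
Proof.
move=> k0 mc sc; have icn i := intgM sc (noise_sqint i l k0).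
under eq_Rintegral do rewrite batch_noiseE mulrCA mulr_sumr.
rewrite RintegralZl//; last exact: intg_sum.
rewrite Rintegral_sum// big1 ?mulr0// => i _.
by apply: noise_orth => //; apply: measurable_fun_sigma_typeS mc; exact: past_others.
Qed.

(** For [i != j] the sample [(k, i)] belongs to [others k j], so the noise of [i] can act as the
    factor [c] in [noise_orth]. *)
Lemma noise_uncorrelated k i j l : (0 < k)%N -> i != j ->
  \int[P]_w (noise k i l w * noise k j l w) = 0.
Proof.
move=> k0 ij; apply: noise_orth => //; last exact: noise_sqint.
have xij : others k j (idx k i).
  split; first by rewrite /= k0 leqnn.
  by move=> /eqP; rewrite -tag_eqE /tag_eq eqxx tagged_asE (negPf ij).
apply: measurable_funB; last exact: grad_meas (@past_others k j).
apply: g_comp; last first.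
  exact: (@measurable_fun_sigma_type _ _ _ _ _ X (others k j) (idx k i)).
by apply: measurable_fun_sigma_typeS (x_measurable k0); exact: past_others.
Qed.

(** In the expanded square the off-diagonal terms vanish; [m] diagonal ones remain, each at most
    [sigma^2], under the factor [1 / m^2]. *)
Lemma batch_noise_var k : (0 < k)%N ->
  \int[P]_w dot (batch_noise k w) (batch_noise k w) <= sigma ^+ 2 / m%:R.
Proof.
move=> k0.
have inn i j l := intgM (noise_sqint i l k0) (noise_sqint j l k0).
under eq_Rintegral do rewrite dotE.
rewrite Rintegral_sum; last by move=> l; apply: intgM; exact: batch_noise_sqint.
have E l : \int[P]_w (batch_noise k w l ord0 * batch_noise k w l ord0) =
    m%:R^-1 ^+ 2 * \sum_i \int[P]_w (noise k i l w ^+ 2).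
  under eq_Rintegral do rewrite !batch_noiseE mulrACA -expr2 big_distrlr /=.
  have iin i : intg P (fun w => \sum_j noise k i l w * noise k j l w).
    exact: intg_sum.
  rewrite RintegralZl//; last exact: intg_sum.
  rewrite Rintegral_sum//; congr (_ * _); apply: eq_bigr => i _.
  rewrite Rintegral_sum// (bigD1 i)//= big1 ?addr0.
    by apply: eq_Rintegral => w _; rewrite expr2.
  by move=> j ji; apply: noise_uncorrelated; rewrite 1?eq_sym.
rewrite (eq_bigr _ (fun l _ => E l)) -mulr_sumr exchange_big/=.
have : \sum_(i < m) \sum_l \int[P]_w (noise k i l w ^+ 2) <=
    \sum_(i < m) sigma ^+ 2.
  by apply: ler_sum => i _; exact: noise_var.
rewrite sumr_const card_ord -(mulr_natl (sigma ^+ 2)) => h.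
have := ler_wpM2l (_ : 0 <= m%:R^-1 ^+ 2 :> R) h; rewrite sqr_ge0 => /(_ isT).
by move=> /le_trans; apply; rewrite expr2 -mulrA mulKf// mulrC.
Qed.

Lemma expected_descent k : (0 < k)%N ->
  \int[P]_w f (x k.+1 w) <= \int[P]_w f (x k w)
    + (L / 2 * alpha k ^+ 2 * ku ^+ 2 - alpha k * kl) *
      \int[P]_w dot (grad f (x k w)) (grad f (x k w))
    + L / 2 * alpha k ^+ 2 * ku ^+ 2 * (sigma ^+ 2 / m%:R).
Proof.
move=> k0; have [_ _ _ posH xS] := iter.
set A := L / 2 * alpha k ^+ 2 * ku ^+ 2 - alpha k * kl.
set B := L / 2 * alpha k ^+ 2 * ku ^+ 2.
(* The vector paired with the noise in [sqn_step_descent]. It depends on the past alone, so that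
   term integrates to 0. *)
pose c w := (- alpha k) *: (H k w *m grad f (x k w)) +
  (L * alpha k ^+ 2 * ku ^+ 2) *: grad f (x k w).
have cE w l : c w l ord0 = (- alpha k) * (H k w *m grad f (x k w)) l ord0 +
  (L * alpha k ^+ 2 * ku ^+ 2) * grad f (x k w) l ord0.
  by rewrite /c mxE [in LHS]mxE [X in _ + X = _]mxE.
have mc l : measurable_fun [set: sigma_type X (past k)] (fun w => c w l ord0).
  under eq_fun do rewrite cE.
  have mg j : measurable_fun [set: sigma_type X (past k)]
      (fun w => grad f (x k w) j ord0).
    exact: grad_meas.
  apply: measurable_funD; apply: measurable_funM => //.
  under eq_fun do rewrite mxE.
  by apply: measurable_sum => i; apply: measurable_funM => //; exact: H_measurable.
have sc l : sqint P (fun w => c w l ord0).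
  under eq_fun do rewrite cE.
  by apply: sqintD; apply: sqintZ; [exact: Hgrad_sqint|exact: grad_sqint].
have ice l := intgM (sc l) (batch_noise_sqint l k0).
have ie : intg P (fun w => dot (batch_noise k w) (batch_noise k w)).
  under eq_fun do rewrite dotE.
  by apply: intg_sum => l; apply: intgM; exact: batch_noise_sqint.
have idc : intg P (fun w => dot (c w) (batch_noise k w)).
  by under eq_fun do rewrite dotE; exact: intg_sum.
have ig := dot_grad_intg k0.
have iff := f_intg k0.
have dc0 : \int[P]_w dot (c w) (batch_noise k w) = 0.
  under eq_Rintegral do rewrite dotE.
  by rewrite Rintegral_sum// big1// => l _; exact: batch_noise_orth.
have i1 := intgD iff (intgZ A ig).
have i2 := intgD i1 (intgZ B ie).
have := le_Rintegral_ae (f_intg (isT : (0 < k.+1)%N)) (intgD i2 idc) _.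
rewrite RintegralD// dc0 addr0 RintegralD//; last exact: intgZ.
rewrite RintegralD//; last exact: intgZ.
rewrite !RintegralZl//.
move=> h; apply: le_trans (h _) _; last first.
  rewrite lerD2l ler_wpM2l ?batch_noise_var// /B.
  by rewrite !mulr_ge0 ?sqr_ge0// ltW.
apply: filterS (as3 k0) => w [klH Hku]; have [sH _] := posH k w k0.
rewrite xS//.
have -> : batch_gradient g (m := fun=> m) xi x k w =
  grad f (x k w) + batch_noise k w by rewrite addrC subrK.
exact: (sqn_step_descent (x k w) (batch_noise k w) as1 L_gt0 kl_gt0 ku_gt0 sH
  klH Hku (alpha_ge0 k)).
Qed.

End SqnStep.

(** * Rate of convergence *)

(** Lets one outcome be picked at which the bounds on [H 1] hold, in order to compare [kl] with
    [ku]. *)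
Lemma ae_exists d (T : measurableType d) (R : realType) (P : probability T R)
    (Q : T -> Prop) : {ae P, forall w, Q w} -> exists w, Q w.
Proof.
move=> [A [mA PA0 QA]]; apply: contrapT => nQ.
have AT : A = setT.
  by apply/seteqP; split=> // w _; apply: QA => /= Qw; apply: nQ; exists w.
have : P setT = 0%E by rewrite -AT.
by rewrite probability_setT => /eqP; rewrite onee_eq0.
Qed.

Section SqnRate.
Context {R : realType} {n d m : nat}.
Context {dO : measure_display} {Omega : measurableType dO}.
Variables (P : probability Omega R) (mu : probability (borel 'cV[R]_d) R).
Variable g : 'cV[R]_n -> 'cV[R]_d -> 'cV[R]_n.
Variable xi : nat -> 'I_m -> Omega -> borel 'cV[R]_d.
Variable x : nat -> Omega -> borel 'cV[R]_n.
Variable H : nat -> Omega -> 'M[R]_n.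
Variables (x1 : 'cV[R]_n) (H1 : 'M[R]_n).
Variables (f : 'cV[R]_n -> R) (L flow sigma kl ku beta Mf : R).
Hypotheses (L_gt0 : 0 < L) (kl_gt0 : 0 < kl) (ku_gt0 : 0 < ku) (m_gt0 : (0 < m)%N).
Hypotheses (beta_gt0 : 0 < beta) (beta_lt1 : beta < 1).
Let alpha (k : nat) : R := kl / (L * ku ^+ 2) * k%:R `^ (- beta).
Hypothesis iter : sqn_iteration P g (m := fun=> m) xi x H mu alpha x1 H1.
Hypotheses (as1 : AS1 f L flow) (as2 : AS2 P g (m := fun=> m) xi x f sigma).
Hypotheses (as3 : AS3 P H kl ku) (as4 : AS4 (m := fun=> m) xi H).
Hypothesis fMf : forall k, (0 < k)%N -> ('E_P[fun w => f (x k w)] <= Mf%:E)%E.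

Let a k := \int[P]_w dot (grad f (x k w)) (grad f (x k w)).
Let A := 2 * L * ku ^+ 2 / kl ^+ 2.
Let phi k := A * (\int[P]_w f (x k w) - flow).
Let y (k : nat) : R := k%:R `^ beta.

Let alpha_ge0 k : 0 <= alpha k.
Proof. by rewrite /alpha !mulr_ge0 ?powR_ge0 ?invr_ge0 ?mulr_ge0 ?sqr_ge0// ltW. Qed.

Let A_gt0 : 0 < A.
Proof. by rewrite /A divr_gt0 ?mulr_gt0 ?exprn_gt0. Qed.

Let fi k (k0 : (0 < k)%N) : intg P (fun w => f (x k w)) :=
  f_intg iter as1 as4 fMf k0.

Let dot_grad_intg k : (0 < k)%N ->
  intg P (fun w => dot (grad f (x k w)) (grad f (x k w))).
Proof.
move=> k0; under eq_fun do rewrite dotE.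
by apply: intg_sum => l; apply: intgM; exact: (grad_sqint L_gt0 iter as1 as4 fMf).
Qed.

Let flow_le k : (0 < k)%N -> flow <= \int[P]_w f (x k w).
Proof.
move=> k0; have [_ flowf _] := as1.
have -> : flow = \int[P]_w (cst flow w).
  by rewrite Rintegral_cst// [X in fine X]probability_setT mulr1.
by apply: le_Rintegral => //; [exact: intg_cst|exact: fi].
Qed.

Let phi_ge0 k : (0 < k)%N -> 0 <= phi k.
Proof. by move=> k0; rewrite mulr_ge0 ?(ltW A_gt0)// subr_ge0 flow_le. Qed.

Let phi_le k : (0 < k)%N -> phi k <= A * (Mf - flow).
Proof.
move=> k0; rewrite ler_pM2l// lerD2r -lee_fin -EFin_Rintegral; last exact: fi.
by have := fMf k0; rewrite expectation.unlock.
Qed.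

Let a_le_phi k : (0 < k)%N -> a k <= phi k.
Proof.
(* In dimension 0 the inequality [kl <= ku] may fail, but the gradient has no coordinates and [a k]
   is 0. Otherwise [kl <= ku] gives [2 L <= A]. *)
move=> k0; have [n0|] := posnP n.
  rewrite (_ : a k = 0) ?phi_ge0// /a.
  rewrite (_ : (fun w => _) = cst 0).
    by rewrite Rintegral_cst// mul0r.
  apply/funext => w; rewrite dotE big1// => i.
  by have := ltn_ord i; rewrite {2}n0.
move=> n0.
have [w [klH Hku]] := ae_exists (as3 (isT : (0 < 1)%N)).
have klku : kl <= ku by exact: loewner_scalar_le klH Hku.
apply: (@le_trans _ _ (2 * L * (\int[P]_w f (x k w) - flow))); last first.
  rewrite ler_wpM2r ?subr_ge0 ?flow_le// /A ler_pdivlMr ?exprn_gt0//.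
  by rewrite ler_pM2l ?mulr_gt0// lerXn2r ?nnegrE ?(ltW kl_gt0) ?(ltW ku_gt0).
have ifl := intgD (fi k0) (intg_cst P (- flow)).
have -> : \int[P]_w f (x k w) - flow = \int[P]_w (f (x k w) + - flow).
  rewrite RintegralD//; [|exact: fi|exact: intg_cst].
  by rewrite Rintegral_cst// [X in fine X]probability_setT mulr1.
rewrite -RintegralZl//; apply: le_Rintegral => //.
- exact: dot_grad_intg.
- exact: intgZ.
- by move=> z _; exact: grad_sqr_le.
Qed.

Let y_gt0 k : (0 < k)%N -> 0 < y k.
Proof. by move=> k0; rewrite powR_gt0// ltr0n. Qed.

Let descent k : (0 < k)%N ->
  a k * (2 - (y k)^-1) <= y k * (phi k - phi k.+1) + sigma ^+ 2 / m%:R / y k.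
Proof.
move=> k0; have yk := y_gt0 k0.
have := expected_descent L_gt0 kl_gt0 ku_gt0 m_gt0 alpha_ge0 iter as1 as2 as3
  as4 fMf k0.
rewrite -/(a k) /phi /alpha powRN -/(y k) /A.
move: (\int[P]_w f (x k w)) (\int[P]_w f (x k.+1 w)) (a k) (y k) yk => u v b z z0.
set c := sigma ^+ 2 / m%:R.
(* With this step size, the factor [A * z] turns [alpha k * kl] into 2 and
   [L / 2 * alpha k ^+ 2 * ku ^+ 2] into [1 / z]. *)
rewrite -(ler_pM2l (_ : 0 < A * z)); last by rewrite mulr_gt0.
rewrite -subr_ge0 => h; rewrite -subr_ge0; move: h; congr (_ <= _).
by rewrite /A; field; rewrite !gt_eqF.
Qed.

Lemma sqn_rate N : (0 < N)%N ->
  (mean_sq_grad P x f N <=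
   (2 * L * (Mf - flow) * ku ^+ 2 / kl ^+ 2 * N%:R `^ (beta - 1) +
    sigma ^+ 2 / ((1 - beta) * m%:R) * (N%:R `^ (- beta) - N%:R^-1))%:E)%E.
Proof.
move=> N0; have N_gt0 : 0 < N%:R :> R by rewrite ltr0n.
have m_gt0' : 0 < m%:R :> R by rewrite ltr0n.
have -> : mean_sq_grad P x f N = (N%:R^-1 * \sum_(1 <= k < N.+1) a k)%:E.
  rewrite /mean_sq_grad EFinM -sumEFin; congr (_ * _)%E.
  apply: eq_big_nat => k /andP[k0 _].
  rewrite expectation.unlock -EFin_Rintegral; last exact: dot_grad_intg.
  by apply: eq_integral => w _; rewrite enorm_sqr.
rewrite lee_fin.
have s0 : 0 <= sigma ^+ 2 / m%:R by rewrite divr_ge0 ?sqr_ge0.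
have y1 : y 1 = 1 by rewrite /y powR1.
have y_homo k : (0 < k)%N -> y k <= y k.+1.
  by move=> k0; rewrite ge0_ler_powR ?nnegrE ?ler0n ?ler_nat// ltW.
have V_ge0 : 0 <= N%:R^-1 :> R by rewrite invr_ge0 ltW.
have := descent_sum s0 y1 y_homo phi_ge0 phi_le a_le_phi descent N0.
move=> /(ler_wpM2l V_ge0) /le_trans; apply.
have := sum_powRN_le beta_gt0 beta_lt1 N0.
rewrite (eq_bigr (fun k => (y k)^-1)); last by move=> k _; rewrite powRN.
move=> /(ler_wpM2l s0) /(ler_wpM2l V_ge0) h.
rewrite mulrDr; apply: le_trans (lerD (lexx _) h) _.
have NE1 : N%:R `^ (beta - 1) = N%:R^-1 * y N.
  rewrite -(powR_inv1 (ltW N_gt0)) -powRD ?(gt_eqF N_gt0) ?implybT//.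
  by congr powR; rewrite addrC.
have NE2 : N%:R `^ (- beta) = N%:R^-1 * N%:R `^ (1 - beta).
  rewrite -(powR_inv1 (ltW N_gt0)) -powRD ?(gt_eqF N_gt0) ?implybT//.
  by congr powR; ring.
rewrite NE1 NE2 le_eqVlt; apply/orP; left; apply/eqP; rewrite /A.
by field; rewrite !gt_eqF// subr_gt0.
Qed.

End SqnRate.

(** [beta > 1/2] means [- beta <= beta - 1], so the noise term decays at least as fast as the first
    one. *)
Lemma rate_le (R : realType) (D s beta : R) (N : nat) :
  2^-1 < beta -> beta < 1 -> 0 <= s -> (0 < N)%N ->
  D * N%:R `^ (beta - 1) + s * (N%:R `^ (- beta) - N%:R^-1) <=
  (`|D| + s) * N%:R `^ (- (1 - beta)).
Proof.
move=> b1 b2 s0 N0; rewrite opprB mulrDl lerD ?ler_wpM2r ?powR_ge0 ?ler_norm//.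
apply: ler_wpM2l => //; apply: (@le_trans _ _ (N%:R `^ (- beta))).
  by rewrite lerBlDr lerDl invr_ge0.
by rewrite ler_powR ?ler1n//; lra.
Qed.

Unset Implicit Arguments.

Theorem theorem2p3 (R : realType) (L Mf flow kl ku sigma beta : R) (m : nat)
    (L_gt0 : 0 < L) (Mf_gt0 : 0 < Mf) (kl_gt0 : 0 < kl) (ku_gt0 : 0 < ku)
    (sigma_gt0 : 0 < sigma) (m_gt0 : (0 < m)%N)
    (beta_gt : 2^-1 < beta) (beta_lt : beta < 1) :
  exists2 C : R, 0 < C &
  forall (n d : nat) (mu : probability (borel 'cV[R]_d) R) (Xi : set 'cV[R]_d)
    (F : 'cV[R]_n * 'cV[R]_d -> R) (f : 'cV[R]_n -> R)
    (g : 'cV[R]_n -> 'cV[R]_d -> 'cV[R]_n)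
    (dO : measure_display) (Omega : measurableType dO) (P : probability Omega R)
    (xi : nat -> 'I_m -> Omega -> borel 'cV[R]_d)
    (x : nat -> Omega -> borel 'cV[R]_n) (H : nat -> Omega -> 'M[R]_n)
    (x1 : 'cV[R]_n) (H1 : 'M[R]_n),
  let alpha := fun k : nat => kl / (L * ku ^+ 2) * k%:R `^ (- beta) in
  stochastic_objective mu Xi F f ->
  sqn_iteration P g (m := fun=> m) xi x H mu alpha x1 H1 ->
  AS1 f L flow ->
  AS2 P g (m := fun=> m) xi x f sigma ->
  AS3 P H kl ku ->
  AS4 (m := fun=> m) xi H ->
  (forall k : nat, (0 < k)%N -> ('E_P[fun w => f (x k w)] <= Mf%:E)%E) ->
  (forall N : nat, (0 < N)%N ->
     (mean_sq_grad P x f N <=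
      (2 * L * (Mf - flow) * ku ^+ 2 / kl ^+ 2 * N%:R `^ (beta - 1) +
       sigma ^+ 2 / ((1 - beta) * m%:R) * (N%:R `^ (- beta) - N%:R^-1))%:E)%E)
  /\
  (forall eps : R, 0 < eps < 1 ->
     exists N0 : nat,
       [/\ (0 < N0)%N, N0%:R <= C * eps `^ (- (1 - beta)^-1) &
           forall N : nat, (N0 <= N)%N -> (mean_sq_grad P x f N < eps%:E)%E]).
Proof.
have beta_gt0 : 0 < beta by apply: lt_trans beta_gt; rewrite invr_gt0.
have p_gt0 : 0 < 1 - beta by rewrite subr_gt0.
set D := 2 * L * (Mf - flow) * ku ^+ 2 / kl ^+ 2.
set s := sigma ^+ 2 / ((1 - beta) * m%:R).
have s_ge0 : 0 <= s by rewrite divr_ge0 ?sqr_ge0// mulr_ge0// ltW.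
(* [C] is fixed before the process is introduced, when [flow <= Mf] is not yet available; hence
   [|D|] in place of [D]. *)
exists ((`|D| + s) `^ (1 - beta)^-1 + 1).
  by rewrite ltr_wpDl ?powR_ge0.
move=> n d mu Xi F f g dO Omega P xi x H x1 H1 alpha _ iter as1 as2 as3 as4 fMf.
have rate N : (0 < N)%N -> (mean_sq_grad P x f N <=
    (D * N%:R `^ (beta - 1) + s * (N%:R `^ (- beta) - N%:R^-1))%:E)%E.
  exact: (sqn_rate L_gt0 kl_gt0 ku_gt0 m_gt0 beta_gt0 beta_lt iter as1 as2 as3 as4).
split=> // eps /andP[eps0 eps1].
have [N0 [N0_gt0 N0_le N0P]] :=
  powR_threshold (addr_ge0 (normr_ge0 D) s_ge0) p_gt0 eps0 eps1.
exists N0; split=> // N N0N; have N_gt0 : (0 < N)%N by exact: leq_trans N0N.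
apply: le_lt_trans (rate N N_gt0) _; rewrite lte_fin.
exact: le_lt_trans (rate_le D beta_gt beta_lt s_ge0 N_gt0) (N0P N N0N).
Qed.
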